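(* Let $1 \le k < n$ be integers and let $A \subset \mathbb{R}^n$ be a bounded set with $\dim A = \overline{\dim}_B A$. Suppose there exists a set $F \subseteq \mathrm{Gr}(n,k)$, with $t := \dim_P F$, such that $\pi_V$ is almost dimension conserving for $A$ for all $V \in \mathrm{Gr}(n,k) \setminus F$. Then, for all $0 \le s < \dim A$, $$\dim_P \{ V \in \mathrm{Gr}(n,k) : \dim \pi_V(A) \le s \} \le \max\big( k(n-k) - (k-s),\ t \big).$$
   Context: $\mathrm{Gr}(n,k)$ is the Grassmannian of $k$-dimensional linear subspaces of $\mathbb{R}^n$, with the metric $d(V,W) = \|\pi_V - \pi_W\|$ (operator norm), where $\pi_V : \mathbb{R}^n \to V$ denotes the orthogonal projection onto $V$. $\dim$ denotes Hausdorff dimension, with the convention $\dim \varnothing := -\infty$. For a bounded subset $B$ of a metric space $X$ and $\delta > 0$, $N(B,\delta)$ is the least number of closed balls of radius $\delta$ needed to cover $B$, and the upper box (Minkowski) dimension is $\overline{\dim}_B B := \inf\{ r \ge 0 : \limsup_{\delta \downarrow 0} N(B,\delta)\delta^r = 0\}$. The packing dimension of $B \subseteq X$ is $\dim_P B := \inf\{ \sup_{i} \overline{\dim}_B B_i : B = \bigcup_{i=1}^\infty B_i,\ B_i \text{ bounded} \}$. A Lipschitz function $f : \mathbb{R}^n \to \mathbb{R}^m$ is almost dimension conserving for a set $A \subseteq \mathbb{R}^n$ if there exists $\Delta \ge 0$ such that, for every $\varepsilon > 0$, $$\Delta + \dim \big\{ y \in f(A) : \dim(A \cap f^{-1}(y))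 \ge \Delta - \varepsilon \big\} \ge \dim A.$$ This is applied to $f = \pi_V$, identifying $V$ with $\mathbb{R}^k$. *)

(* Defs.v *)
From HB Require Import structures.
From mathcomp Require Import all_boot all_order all_algebra.
From mathcomp Require Import sesquilinear.
From mathcomp Require Import all_classical all_reals all_analysis.
From mathcomp Require Import ring lra.

Set Implicit Arguments.
Unset Strict Implicit.
Unset Printing Implicit Defensive.

Import Order.TTheory GRing.Theory Num.Theory.
Import numFieldNormedType.Exports.

Local Open Scope classical_set_scope.
Local Open Scope ring_scope.

Section dimensions.
Context {R : realType} {T : metricType R}.
Implicit Types (A B U : set T) (s r d : R).

Definition mbounded B := exists M : R, forall x y, B x -> B y -> mdist x y <= M.

Local Open Scope ereal_scope.

(* [diam set0 = -oo]; [diam_pow] below never uses this value. *)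
Definition diam U : \bar R := ereal_sup [set (mdist x y)%:E | x in U & y in U].

(* The convention for the empty set matters for [s = 0] only: a nonempty [U]
   has [diam U `^ 0 = 1]. *)
Definition diam_pow s U : \bar R :=
  if U == set0 then 0 else (diam U `^ s)%E.

Definition hausdorff_premeasure s d A : \bar R :=
  ereal_inf [set \sum_(0 <= i <oo) diam_pow s (U i) | U in
    [set U : (set T)^nat |
       (forall i, diam (U i) <= d%:E) /\ A `<=` \bigcup_i U i]].

Definition hausdorff_measure s A : \bar R :=
  ereal_sup [set hausdorff_premeasure s d A | d in [set d | (0 < d)%R]].

Definition hausdorff_dim A : \bar R :=
  if A == set0 then -oo
  else ereal_inf [set s%:E | s in [set s | (0 <= s)%R /\
                                           hausdorff_measure s A = 0]].

(* The balls are [{y | mdist x y <= d}]; the library's [closed_ball] is the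
   closure of the open ball, which may be smaller. The value is [+oo] when no
   finite cover exists. *)
Definition covering_number B d : \bar R :=
  ereal_inf [set m%:R%:E | m in [set m : nat |
    exists c : 'I_m -> T, forall x, B x -> exists i, (mdist (c i) x <= d)%R]].

Definition upper_box_dim B : \bar R :=
  ereal_inf [set r%:E | r in [set r | (0 <= r)%R /\
    limf_esup (fun d : R => covering_number B d * (d `^ r)%:E) 0^'+ = 0]].

Definition packing_dim B : \bar R :=
  ereal_inf [set ereal_sup (range (fun i => upper_box_dim (Bs i))) | Bs in
    [set Bs : (set T)^nat |
       (forall i, mbounded (Bs i)) /\ B = \bigcup_i Bs i]].

End dimensions.

Definition lipschitz_map {R : realType} {T U : metricType R} (f : T -> U) :=
  exists L : R, forall x y, mdist (f x) (f y) <= L * mdist x y.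

Definition almost_dim_conserving {R : realType} {T U : metricType R}
    (f : T -> U) (A : set T) :=
  lipschitz_map f /\
  exists2 Delta : R, 0 <= Delta & forall eps : R, 0 < eps ->
    (hausdorff_dim A <=
     Delta%:E + hausdorff_dim [set y | (f @` A) y /\
       (Delta - eps)%:E <= hausdorff_dim (A `&` f @^-1` [set y])])%E.

(* ['rV[R]_n] is already a pseudometric space for the sup norm; this copy is
   given the Euclidean distance. *)
Definition euclid (R : realType) (n : nat) : Type := 'rV[R]_n.

HB.instance Definition _ (R : realType) n := Vector.on (euclid R n).

Section euclidean.
Context {R : realType} {n : nat}.
Implicit Types x y z : euclid R n.

Definition dotp x y : R := \sum_(i < n) (x : 'rV_n) 0 i * (y : 'rV_n) 0 i.

Lemma dotpC x y : dotp x y = dotp y x.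
Proof. by apply: eq_bigr => i _; rewrite mulrC. Qed.

Lemma dotp_linearl y : scalar (dotp ^~ y).
Proof.
move=> a u v; rewrite /dotp mulr_sumr -big_split; apply: eq_bigr => i _ /=.
by rewrite !mxE mulrDl mulrA.
Qed.

Lemma dotp_linearr x : scalar (dotp x).
Proof. by move=> a u v; rewrite !(dotpC x) dotp_linearl. Qed.

HB.instance Definition _ :=
  bilinear_isBilinear.Build R (euclid R n) (euclid R n) R *%R *%R dotp
    (dotp_linearl, dotp_linearr).

Lemma dotp_hermitian x y : dotp x y = (-1) ^+ false * idfun (dotp y x).
Proof. by rewrite expr0 mul1r dotpC. Qed.

HB.instance Definition _ :=
  isHermitianSesquilinear.Build R (euclid R n) false idfun dotp dotp_hermitian.

Lemma dotp_ge0 x : 0 <= dotp x x.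
Proof. by apply: sumr_ge0 => i _; rewrite -expr2 sqr_ge0. Qed.

Lemma dotp_eq0 x : dotp x x = 0 -> x = 0.
Proof.
move=> /eqP; rewrite psumr_eq0 => [/allP x0|i _]; last by rewrite -expr2 sqr_ge0.
apply/rowP => i; rewrite mxE; apply/eqP.
by have := x0 i (mem_index_enum i); rewrite /= mulf_eq0 orbb.
Qed.

Lemma dotp_gt0 x : x != 0 -> 0 < dotp x x.
Proof.
move=> x0; rewrite lt_def dotp_ge0 andbT.
by apply: contra x0 => /eqP/dotp_eq0 ->.
Qed.

HB.instance Definition _ := isDotProduct.Build R (euclid R n) dotp dotp_gt0.

Definition enorm x : R := Num.sqrt (dotp x x).

Definition orthocompl (V : {vspace euclid R n}) : {vspace euclid R n} :=
  orthov (dotp : {symmetric euclid R n}) V.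

Lemma orthocomplP (V : {vspace euclid R n}) x :
  reflect {in V, forall v, dotp x v = 0} (x \in orthocompl V).
Proof. exact: (@mem_orthovP R false idfun (euclid R n) dotp V x). Qed.

End euclidean.

Section enorm_theory.
Context {R : realType} {n : nat}.
Implicit Types x y z : euclid R n.

Lemma enorm_ge0 x : 0 <= enorm x. Proof. exact: sqrtr_ge0. Qed.

Lemma enorm0 : enorm (0 : euclid R n) = 0.
Proof. by rewrite /enorm linear0r sqrtr0. Qed.

Lemma enorm_sqr x : enorm x ^+ 2 = dotp x x.
Proof. by rewrite /enorm sqr_sqrtr// dotp_ge0. Qed.

Lemma enorm_eq0 x : enorm x = 0 -> x = 0.
Proof. by move=> x0; apply: dotp_eq0; rewrite -enorm_sqr x0 expr0n. Qed.

Lemma enormZ (a : R) x : enorm (a *: x) = `|a| * enorm x.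
Proof.
by rewrite /enorm linearZl_LR linearZr_LR/= mulrA -expr2 sqrtrM ?sqr_ge0// sqrtr_sqr.
Qed.

Lemma enormN x : enorm (- x) = enorm x.
Proof. by rewrite -scaleN1r enormZ normrN1 mul1r. Qed.

Lemma dotp_le x y : dotp x y <= enorm x * enorm y.
Proof.
have [->|x0] := eqVneq x 0; first by rewrite linear0l enorm0 mul0r.
have [->|y0] := eqVneq y 0; first by rewrite linear0r enorm0 mulr0.
have nx : 0 < enorm x by rewrite lt_def enorm_ge0 andbT; apply: contra x0 => /eqP/enorm_eq0 ->.
have ny : 0 < enorm y by rewrite lt_def enorm_ge0 andbT; apply: contra y0 => /eqP/enorm_eq0 ->.
have := dotp_ge0 (enorm y *: x - enorm x *: y).
rewrite linearBl/= !linearBr/= !linearZl_LR/= !linearZr_LR/= (dotpC y x) -!enorm_sqr.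
move: nx ny; set a := enorm x; set b := enorm y; set c := dotp x y => a0 b0 h.
rewrite -subr_ge0 -(pmulr_rge0 _ (mulr_gt0 a0 b0)) -(pmulr_rge0 _ (ltr0Sn R 1)).
by apply: le_trans h _; rewrite le_eqVlt; apply/orP; left; apply/eqP; rewrite /GRing.scale/=; ring.
Qed.

Lemma enormD x y : enorm (x + y) <= enorm x + enorm y.
Proof.
rewrite -ler_sqr ?nnegrE ?addr_ge0 ?enorm_ge0// enorm_sqr.
rewrite linearDl/= !linearDr/= (dotpC y x) -!enorm_sqr.
by have := dotp_le x y; lra.
Qed.

Let edist x y := enorm (x - y).

Let edistxx x : edist x x = 0. Proof. by rewrite /edist subrr enorm0. Qed.

Let edist_eq0 x y : edist x y = 0 -> x = y.
Proof. by move=> /enorm_eq0/eqP; rewrite subr_eq0 => /eqP. Qed.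

Let edist_sym x y : edist x y = edist y x.
Proof. by rewrite /edist -enormN opprB. Qed.

Let edist_triangle y x z : edist x z <= edist x y + edist y z.
Proof. by rewrite /edist -[x - z](subrKA y) enormD. Qed.

HB.instance Definition _ :=
  isMetric.Build R (euclid R n) edistxx edist_eq0 edist_sym edist_triangle.

End enorm_theory.

Lemma euclid_mdistE (R : realType) n (x y : euclid R n) :
  mdist x y = enorm (x - y).
Proof. by []. Qed.

Section opnorm.
Context {R : realType} {n : nat}.
Implicit Types (f g : 'End(euclid R n)) (x : euclid R n).

Definition opnorm f : R := sup [set enorm (f x) | x in [set x | enorm x <= 1]].

Lemma le_coord_enorm x (i : 'I_n) : `|(x : 'rV_n) 0 i| <= enorm x.
Proof.
rewrite -ler_sqr ?nnegrE ?enorm_ge0// enorm_sqr real_normK ?num_real//.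
rewrite /dotp (bigD1 i)//= -expr2 lerDl.
by apply: sumr_ge0 => j _; rewrite -expr2 sqr_ge0.
Qed.

Lemma opnorm_has_sup f : has_sup [set enorm (f x) | x in [set x | enorm x <= 1]].
Proof.
split; first by exists (enorm (f 0)), 0; rewrite //= enorm0 ler01.
exists (\sum_(i < n) enorm (f (delta_mx 0 i : 'rV[R]_n))) => _ [x /= x1 <-].
rewrite [in enorm _](_ : x = \sum_i (x : 'rV_n) 0 i *: (delta_mx 0 i : 'rV_n)); last exact: row_sum_delta.
rewrite linear_sum/=.
apply: (@le_trans _ _ (\sum_i enorm (f ((x : 'rV_n) 0 i *: (delta_mx 0 i : 'rV_n))))).
  elim/big_ind2 : _ => [|a u b v ua vb|//]; first by rewrite enorm0.
  by rewrite (le_trans (enormD _ _))// lerD.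
apply: ler_sum => i _; rewrite linearZ/= enormZ ler_piMl ?enorm_ge0//.
exact: le_trans (le_coord_enorm x i) x1.
Qed.

Lemma enorm_le_opnorm f x : enorm (f x) <= opnorm f * enorm x.
Proof.
have [->|x0] := eqVneq x 0; first by rewrite linear0 enorm0 mulr0.
have nx : 0 < enorm x by rewrite lt_def enorm_ge0 andbT; apply: contra x0 => /eqP/enorm_eq0 ->.
rewrite -ler_pdivrMr// mulrC -[X in X * _]gtr0_norm ?invr_gt0// -enormZ -linearZ.
apply: (ub_le_sup (opnorm_has_sup f).2); exists ((enorm x)^-1 *: x) => //=.
by rewrite enormZ gtr0_norm ?invr_gt0// mulVf// gt_eqF.
Qed.

Lemma opnorm_eq0 f : opnorm f = 0 -> f = 0.
Proof.
move=> f0; apply/lfunP => x; rewrite lfunE/=; apply: enorm_eq0.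
apply/eqP; rewrite eq_le enorm_ge0 andbT.
by have := enorm_le_opnorm f x; rewrite f0 mul0r.
Qed.

Lemma opnorm_le f (c : R) : (forall x, enorm x <= 1 -> enorm (f x) <= c) -> opnorm f <= c.
Proof.
move=> fc; apply: ge_sup; first exact: (opnorm_has_sup f).1.
by move=> _ [x /= x1 <-]; exact: fc.
Qed.

Lemma le_opnorm f x : enorm x <= 1 -> enorm (f x) <= opnorm f.
Proof. by move=> x1; apply: (ub_le_sup (opnorm_has_sup f).2); exists x. Qed.

Lemma opnorm0 : opnorm 0 = 0.
Proof.
apply/eqP; rewrite eq_le; apply/andP; split.
  by apply: opnorm_le => x _; rewrite lfunE/= enorm0.
by rewrite (le_trans (enorm_ge0 ((0 : 'End(euclid R n)) 0)))// le_opnorm// enorm0 ler01.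
Qed.

Lemma opnormN f : opnorm (- f) = opnorm f.
Proof.
congr sup; apply/seteqP; split => _ [x /= x1 <-]; exists x => //=;
by rewrite lfunE/= enormN.
Qed.

Lemma opnormD f g : opnorm (f + g) <= opnorm f + opnorm g.
Proof.
apply: opnorm_le => x x1; rewrite lfunE/= (le_trans (enormD _ _))//.
by rewrite lerD// le_opnorm.
Qed.

End opnorm.

Section orthogonal_projection.
Context {R : realType} {n : nat}.
Implicit Types (V W : {vspace euclid R n}) (x : euclid R n).

Definition orthproj V : 'End(euclid R n) :=
  daddv_pi V (orthocompl V).

Lemma capv_orthocompl V : (V :&: orthocompl V)%VS = 0%VS.
Proof.
apply/eqP; rewrite -subv0; apply/subvP => x; rewrite memv_cap => /andP[xV].
by move=> /orthocomplP/(_ _ xV)/dotp_eq0 ->; rewrite mem0v.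
Qed.

Lemma addv_orthocompl V : (V + orthocompl V)%VS = fullv.
Proof.
apply/eqP; rewrite eqEdim subvf/= dimv_disjoint_sum ?capv_orthocompl//.
pose b := vbasis V.
pose phi (x : euclid R n) : 'rV[R]_(\dim V) := \row_i dotp x b`_i.
have phi_lin : linear phi.
  by move=> a u v; apply/rowP => i; rewrite !mxE linearPl.
pose phiL := GRing.isLinear.Build _ _ _ _ phi phi_lin.
pose f : {linear euclid R n -> 'rV[R]_(\dim V)} := HB.pack phi phiL.
rewrite -(limg_ker_dim (linfun f) fullv) addnC capfv leq_add//.
  by rewrite (leq_trans (dimvS (subvf _)))// dimvf /dim/= mul1n.
apply: dimvS; apply/subvP => x; rewrite memv_ker lfunE/= => /eqP/rowP phi0.
apply/orthocomplP => v /coord_vbasis ->; rewrite linear_sumr big1//= => i _.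
by rewrite linearZr_LR/=; have := phi0 i; rewrite !mxE => ->; rewrite mulr0.
Qed.

Lemma orthprojP V x : orthproj V x \in V /\
  {in V, forall v, dotp (x - orthproj V x) v = 0}.
Proof.
split; first exact: memv_pi.
apply/orthocomplP.
have := @daddv_pi_add _ _ V (orthocompl V) x (capv_orthocompl V).
rewrite addv_orthocompl memvf => /(_ isT) {1}<-.
by rewrite addrC addKr memv_pi.
Qed.

Lemma orthproj_id V x : x \in V -> orthproj V x = x.
Proof. by move=> xV; rewrite /orthproj daddv_pi_id// capv_orthocompl. Qed.

Lemma orthproj_inj : injective orthproj.
Proof.
suff H V W : orthproj V = orthproj W -> (V <= W)%VS.
  by move=> V W VW; apply/eqP; rewrite eqEsubv !H.
move=> VW; apply/subvP => x xV.
by rewrite -(orthproj_id xV) VW; case: (orthprojP W x).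
Qed.

Lemma enorm_orthproj V x : enorm (orthproj V x) <= enorm x.
Proof.
have [pV xp] := orthprojP V x.
rewrite -ler_sqr ?nnegrE ?enorm_ge0// !enorm_sqr.
rewrite -{3 4}(subrK (orthproj V x) x).
rewrite (@hnormDd _ _ _ _ (@dotp R n : {symmetric euclid R n}))/=.
  by rewrite lerDr dotp_ge0.
exact: xp.
Qed.

Lemma orthproj_lipschitz V : lipschitz_map (orthproj V).
Proof.
by exists 1 => x y; rewrite mul1r !euclid_mdistE -linearB enorm_orthproj.
Qed.

End orthogonal_projection.

Record grassmannian (R : realType) (n k : nat) := Grassmannian {
  grass_space :> {vspace euclid R n};
  grass_dim : \dim grass_space == k }.

HB.instance Definition _ (R : realType) n k :=
  [isSub for @grass_space R n k].
HB.instance Definition _ (R : realType) n k :=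
  [Choice of grassmannian R n k by <:].

Section grassmannian_metric.
Context {R : realType} {n k : nat}.
Implicit Types V W : grassmannian R n k.

Let gdist V W := opnorm (orthproj V - orthproj W).

Let gdistxx V : gdist V V = 0. Proof. by rewrite /gdist subrr opnorm0. Qed.

Let gdist_eq0 V W : gdist V W = 0 -> V = W.
Proof.
move=> /opnorm_eq0/eqP; rewrite subr_eq0 => /eqP/orthproj_inj VW.
exact: val_inj.
Qed.

Let gdist_sym V W : gdist V W = gdist W V.
Proof. by rewrite /gdist -opnormN opprB. Qed.

Let gdist_triangle W V Z : gdist V Z <= gdist V W + gdist W Z.
Proof. by rewrite /gdist -[_ - orthproj Z](subrKA (orthproj W)) opnormD. Qed.

HB.instance Definition _ := isMetric.Build R (grassmannian R n k)
  gdistxx gdist_eq0 gdist_sym gdist_triangle.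

End grassmannian_metric.

Lemma grassmannian_mdistE (R : realType) n k (V W : grassmannian R n k) :
  mdist V W = opnorm (orthproj V - orthproj W).
Proof. by []. Qed.

(* Main.v *)
Require Import Defs.
From HB Require Import structures.
From mathcomp Require Import all_boot all_order all_algebra.
From mathcomp Require Import all_classical all_reals all_analysis.
From mathcomp Require Import ring lra.

Set Implicit Arguments.
Unset Strict Implicit.
Unset Printing Implicit Defensive.

Import Order.TTheory GRing.Theory Num.Theory.
Import numFieldNormedType.Exports.

Local Open Scope classical_set_scope.
Local Open Scope ring_scope.

(** Write [alpha] for the common value of the Hausdorff and upper box dimensions of
    [A], and let [V] be a subspace outside [F] with [dim (proj_V A) <= s]. Almost
    dimension conservation provides [Delta >= alpha - s] and a set of points [y]
    of [V], of dimension about [alpha - Delta], over which the fibres of [A] have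
    dimension about [Delta]. Cover [A] by about [d `^ (- alpha)] balls of radius
    [d]. About [d `^ (- (alpha - Delta))] fibres are distinguishable at scale [d],
    each meets at least [d `^ (- Delta)] balls, and hence there are at least
    [d `^ (- (alpha + Delta))], that is at least [d `^ (- (2 * alpha - s))], pairs
    of balls whose centres project to [d]-close points of [V]. As Hausdorff content
    is small on small balls, the centres may be required to be at distance bounded
    below ([near_pairs_lower], [adc_rich]).

    Conversely, a vector [w] of norm bounded below projects to a vector of length
    at most [2 * d] only for subspaces close to the copy of [Gr(n - 1, k)] formed
    by the subspaces orthogonal to [w], so for at most about
    [d `^ (- (k * (n - k - 1)))] members of a [d]-separated family
    ([spaced_near_orthogonal]; the proof works in the charts of the Grassmannian
    given by maximal minors). Summing over all pairs of balls, of which there are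
    about [d `^ (- (2 * alpha))], a separated family of exceptional subspaces has at
    most about [d `^ (- (k * (n - k - 1) + s))] members
    ([upper_box_dim_rich]). Since [k * (n - k - 1) + s = k * (n - k) - (k - s)],
    this is the required bound on the box dimension.

    The constants above depend on [V]. Splitting the exceptional subspaces into
    countably many classes with uniform constants is harmless for the packing
    dimension, and it is there that countable subadditivity of the content enters.
    The subspaces in [F] are covered by the pieces of [F] that compute its packing
    dimension. *)

(** * Elementary facts on real numbers *)

Section real_facts.
Context {R : realType}.

Lemma truncn_inj_dist (x y : R) : 0 <= x -> 0 <= y ->
  Num.truncn x = Num.truncn y -> `|x - y| <= 1.
Proof.
move=> x0 y0 xy; have /andP[] := truncn_itv x0; have /andP[] := truncn_itv y0.
by rewrite xy -natr1 => *; rewrite ler_norml; lra.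
Qed.

Lemma exists_inv_le (c : R) : 0 < c -> exists N : nat, N.+1%:R^-1 <= c.
Proof.
move=> c0; exists (Num.truncn c^-1); rewrite -[leRHS]invrK lef_pV2 ?posrE ?invr_gt0//.
exact/ltW/truncnS_gt.
Qed.

Lemma gt0_ereal_ge_real (x : \bar R) : (0 < x)%E -> exists2 b : R, 0 < b & (b%:E <= x)%E.
Proof.
case: x => [r|_|//]; first by rewrite lte_fin => r0; exists r.
by exists 1 => //; rewrite leey.
Qed.

End real_facts.

(** * Hausdorff content *)

(** A copy of [T] in which every set is measurable: the outer measure that a
    semiring of sets generates becomes the infimum over arbitrary countable
    covers. *)
Definition all_measurable (T : Type) : Type := T.

Section all_measurable.
Context (T : pointedType).

HB.instance Definition _ := Pointed.on (all_measurable T).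

Let every_set : set (set (all_measurable T)) := setT.

Let every_set0 : every_set set0. Proof. by []. Qed.

Let every_setU : setU_closed every_set. Proof. by []. Qed.

Let every_setC : setC_closed every_set. Proof. by []. Qed.

HB.instance Definition _ :=
  isAlgebraOfSets.Build default_measure_display (all_measurable T)
    every_set0 every_setU every_setC.

End all_measurable.

Section hausdorff_content.
Context {R : realType} {T : metricType R}.
Implicit Types (A B U X : set T) (s r d : R).
Local Open Scope ereal_scope.

(** Hausdorff content of dimension [s]: as the Hausdorff measure, but without any
    bound on the diameters of the covering sets. *)
Definition hausdorff_content s X : \bar R :=
  ereal_inf [set \sum_(0 <= i <oo) diam_pow s (U i) | U in
    [set U : (set T)^nat | X `<=` \bigcup_i U i]].

Lemma diam_pow0 s : diam_pow s (set0 : set T) = 0.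
Proof. by rewrite /diam_pow eqxx. Qed.

Lemma diam_pow_ge0 s U : 0 <= diam_pow s U.
Proof. by rewrite /diam_pow; case: ifP => // _; exact: poweR_ge0. Qed.

Lemma diam_ge0 U : U !=set0 -> 0 <= diam U.
Proof.
move=> [x Ux]; apply: ereal_sup_ubound; exists x => //; exists x => //.
by rewrite mdistxx.
Qed.

Lemma diam_pow_le s d U : (0 <= s)%R -> (0 <= d)%R -> diam U <= d%:E ->
  diam_pow s U <= (d `^ s)%:E.
Proof.
move=> s0 d0 Ud; rewrite /diam_pow; case: eqVneq => [_|/set0P U0].
  by rewrite lee_fin powR_ge0.
rewrite -poweR_EFin; apply: gt0_ler_poweR => //.
  by rewrite in_itv/= diam_ge0//= leey.
by rewrite in_itv/= lee_fin d0 leey.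
Qed.

Lemma diam_pow_lt s d U : (0 <= s)%R -> (0 <= d)%R ->
  diam_pow s U < (d `^ s)%:E -> diam U <= d%:E.
Proof.
move=> s0 d0; rewrite /diam_pow; case: eqVneq => [->|/set0P U0].
  move=> _; rewrite /diam (_ : [set _ | _ in _ & _ in _] = set0) ?ereal_sup0 ?leNye//.
  by apply/seteqP; split => // _ [x []].
move=> Ud; rewrite leNgt; apply: contraTN Ud => dU; rewrite -leNgt -poweR_EFin.
apply: gt0_ler_poweR => //; last exact: ltW.
  by rewrite in_itv/= lee_fin d0 leey.
by rewrite in_itv/= diam_ge0//= leey.
Qed.

Lemma hausdorff_content_ge0 s X : 0 <= hausdorff_content s X.
Proof.
apply: le_ereal_inf_tmp => _ [U _ <-]; apply: nneseries_ge0 => i _ _.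
exact: diam_pow_ge0.
Qed.

(** Countable subadditivity, from that of the outer measure generated by
    [diam_pow s]; the latter is defined on pointed types, hence the case
    distinction. *)
Lemma hausdorff_content_bigcup s (X : (set T)^nat) :
  hausdorff_content s (\bigcup_i X i) <= \sum_(0 <= i <oo) hausdorff_content s (X i).
Proof.
have [[x _]|noT] := pselect ([set: T] !=set0); last first.
  rewrite [leLHS](_ : _ = 0); first by apply: nneseries_ge0 => i _ _; exact: hausdorff_content_ge0.
  apply/eqP; rewrite eq_le hausdorff_content_ge0 andbT.
  apply: ereal_inf_lbound; exists (fun=> set0) => //=.
    by move=> x _; case: noT; exists x.
  by rewrite eseries0// => i _ _; exact: diam_pow0.
pose pT : pointedType := HB.pack (Metric.sort T) (isPointed.Build (Metric.sort T) x).
have contentE Y : mu_ext (diam_pow s : set (all_measurable pT) -> \bar R) Y =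
    hausdorff_content s Y.
  rewrite /mu_ext; congr ereal_inf.
  by apply/seteqP; split => _ [U h <-]; exists U => //; first by case: h.
have := @mu_ext_sigma_subadditive _ (all_measurable pT) R (diam_pow s) (diam_pow_ge0 s) X.
by rewrite contentE; under eq_eseriesr do rewrite contentE.
Qed.

(** If the content vanishes, there are covers with an arbitrarily small sum; each
    term of the sum is then small, so the diameters are small as well and the
    Hausdorff measure vanishes too. *)
Lemma hausdorff_content_gt0 s X : (0 <= s)%R -> s%:E < hausdorff_dim X ->
  0 < hausdorff_content s X.
Proof.
move=> s0 sX; rewrite lt_neqAle hausdorff_content_ge0 andbT.
apply: contraTneq sX => /esym X0.
rewrite /hausdorff_content in X0.
rewrite -leNgt /hausdorff_dim; case: ifPn => [_|_]; first by rewrite leNye.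
apply: ereal_inf_lbound; exists s => //; split => //.
rewrite /hausdorff_measure; apply/eqP; rewrite eq_le; apply/andP; split; last first.
  apply: le_ereal_sup_tmp; exists (hausdorff_premeasure s 1 X); first by exists 1%R => //=.
  apply: le_ereal_inf_tmp => _ [U _ <-]; apply: nneseries_ge0 => i _ _.
  exact: diam_pow_ge0.
apply: ge_ereal_sup => _ [d /= d0 <-].
apply/lee_addgt0Pr => e e0; rewrite add0e.
have ed0 : 0 < (Num.min e (d `^ s))%:E by rewrite lte_fin lt_min e0 powR_gt0.
have [_ [U XU <-] Ue] : exists2 y, [set \sum_(0 <= i <oo) diam_pow s (U i) | U in
    [set U : (set T)^nat | X `<=` \bigcup_i U i]] y & y < (Num.min e (d `^ s))%:E.
  by apply: ereal_inf_lt; rewrite X0.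
apply: (@le_trans _ _ (\sum_(0 <= i <oo) diam_pow s (U i))); last first.
  by rewrite (le_trans (ltW Ue))// lee_fin ge_min lexx.
apply: ereal_inf_lbound; exists U => //; split => // i.
apply: (@diam_pow_lt s) => //; first exact: ltW.
apply: (@lt_le_trans _ _ (Num.min e (d `^ s))%:E); last by rewrite lee_fin ge_min lexx orbT.
apply: le_lt_trans Ue.
rewrite (@nneseries_split _ _ 0%N i.+1); last by move=> *; exact: diam_pow_ge0.
rewrite add0n big_nat_recr//=.
rewrite -[leLHS]addr0 -[leLHS]add0r addrA; apply: leeD.
  by apply: leeD => //; apply: sume_ge0 => j _; exact: diam_pow_ge0.
by apply: nneseries_ge0 => j _ _; exact: diam_pow_ge0.
Qed.

Lemma hausdorff_content_cover s X (U : seq (set T)) :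
  (forall x, X x -> exists2 V, V \in U & V x) ->
  hausdorff_content s X <= \sum_(V <- U) diam_pow s V.
Proof.
move=> XU; apply: ereal_inf_lbound.
exists (fun i => nth set0 U i) => /=.
  by move=> x /XU[V VU Vx]; exists (index V U) => //; rewrite nth_index.
rewrite (@nneseries_split _ _ 0%N (size U)); last by move=> *; exact: diam_pow_ge0.
rewrite add0n [X in _ + X](_ : _ = 0) ?adde0.
  by rewrite (big_nth set0).
by apply: eseries0 => i /= Ui _; rewrite nth_default ?diam_pow0.
Qed.

Lemma hausdorff_content_bigcup_gt0 s (X : (set T)^nat) :
  0 < hausdorff_content s (\bigcup_i X i) -> exists i, 0 < hausdorff_content s (X i).
Proof.
move=> X0; apply: contrapT => /forallNP nX.
have := lt_le_trans X0 (hausdorff_content_bigcup s X).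
rewrite eseries0 ?ltxx// => i _ _; apply/eqP; rewrite eq_le hausdorff_content_ge0 andbT.
by rewrite leNgt; exact/negP.
Qed.

(** Closed ball of the metric, written with the inequality on distances. *)
Definition cball (x : T) r : set T := [set z | (mdist x z <= r)%R].

Lemma diam_pow_cball s r (x : T) : (0 <= s)%R -> (0 <= r)%R ->
  diam_pow s (cball x r) <= ((2 * r) `^ s)%:E.
Proof.
move=> s0 r0; apply: diam_pow_le; rewrite ?mulr_ge0//.
apply: ge_ereal_sup => _ [y yx [z zx <-]]; rewrite lee_fin.
rewrite (le_trans (metric_triangle _ x _))// (metric_sym y) mulr2n mulrDl mul1r lerD//.
Qed.

Lemma hausdorff_content_card s d X (l : seq T) :
  (0 <= s)%R -> (0 <= d)%R ->
  (forall y, X y -> exists2 z, z \in l & (mdist y z <= d)%R) ->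
  hausdorff_content s X <= ((size l)%:R * (2 * d) `^ s)%:E.
Proof.
move=> s0 d0 Xl.
apply: (@le_trans _ _ (\sum_(B <- [seq cball z d | z <- l]) diam_pow s B)%E).
  apply: hausdorff_content_cover => y /Xl[z zl yz].
  exists (cball z d); last by rewrite /cball/= metric_sym.
  exact: map_f.
rewrite big_map.
apply: (@le_trans _ _ (\sum_(j <- l) ((2 * d) `^ s)%:E)%E).
  by apply: lee_sum => j _; exact: diam_pow_cball.
by rewrite sumEFin lee_fin big_const_seq count_predT iter_addr_0 -[leLHS]mulr_natl.
Qed.

Lemma hausdorff_dim_le A B : A `<=` B -> hausdorff_dim A <= hausdorff_dim B.
Proof.
move=> AB; rewrite {1}/hausdorff_dim; case: ifPn => [|/set0P[x Ax]]; first by rewrite leNye.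
rewrite /hausdorff_dim; case: eqVneq => [B0|_].
  by move: (AB _ Ax); rewrite B0.
apply: ereal_inf_le_tmp => _ [s [s0 B0] <-]; exists s => //; split => //.
apply/eqP; rewrite eq_le; apply/andP; split; last first.
  apply: le_ereal_sup_tmp; exists (hausdorff_premeasure s 1 A); first by exists 1%R => //=.
  apply: le_ereal_inf_tmp => _ [U _ <-]; apply: nneseries_ge0 => i _ _.
  exact: diam_pow_ge0.
rewrite -B0; apply: ge_ereal_sup => _ [d d0 <-].
apply: le_ereal_sup_tmp; exists (hausdorff_premeasure s d B); first by exists d.
apply: ereal_inf_le_tmp => _ [U [Ud BU] <-]; exists U => //; split => //.
exact: subset_trans BU.
Qed.

End hausdorff_content.

(** * Spaced families and box dimension *)

Section spaced_families.
Context {R : realType} {T : metricType R}.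
Implicit Types (X : set T) (r : R) (s : seq T).

(** The members of [s] are pairwise at distance greater than [r]. *)
Definition spaced r s := pairwise (fun x y => r < mdist x y) s.

Lemma pairwise_spaced r s : spaced r s ->
  {in s &, forall x y, x != y -> r < mdist x y}.
Proof.
elim: s => // a s IH /=; rewrite /spaced/= => /andP[/allP as_ /IH h] x y.
rewrite !inE => /predU1P[->|xs] /predU1P[->|ys]; first by rewrite eqxx.
- by move=> _; exact: as_.
- by move=> _; rewrite metric_sym; exact: as_.
- exact: h.
Qed.

Lemma spaced_uniq r s : 0 <= r ->
  spaced r s -> uniq s.
Proof.
move=> r0; elim: s => // a s IH /=; rewrite /spaced/= => /andP[/allP as_ /IH ->].
rewrite andbT; apply/negP => /as_; rewrite mdistxx ltNge r0.
by [].
Qed.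

Lemma spaced_filter r (P : pred T) s :
  spaced r s -> spaced r [seq x <- s | P x].
Proof. by move=> ss; apply: subseq_pairwise ss; exact: filter_subseq. Qed.

(** A bound on the size of the spaced families in [X] yields a maximal one, and
    the balls around its members cover [X]. *)
Lemma maximal_spaced X r (M : nat) :
  (forall s, (forall x, x \in s -> X x) -> spaced r s -> (size s <= M)%N) ->
  exists s, [/\ forall x, x \in s -> X x, spaced r s &
    forall x, X x -> exists2 y, y \in s & mdist x y <= r].
Proof.
move=> XM.
pose P m := `[< exists s, [/\ forall x, x \in s -> X x, spaced r s & size s = m] >].
have P0 : exists m, P m by exists 0%N; apply/asboolP; exists [::].
have PM m : P m -> (m <= M)%N by move=> /asboolP[s [sX ss <-]]; exact: XM.
case: (ex_maxnP P0 PM) => _ /asboolP[s [sX ss <-]] smax.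
exists s; split => // x Xx; apply: contrapT => nx.
have /smax : P (size (x :: s)); last by rewrite ltnn.
apply/asboolP; exists (x :: s); split => //.
  by move=> y; rewrite inE => /predU1P[->//|]; exact: sX.
rewrite /spaced/= -/(spaced r s) ss andbT; apply/allP => y ys; rewrite ltNge; apply/negP => xy.
by apply: nx; exists y.
Qed.

End spaced_families.

Section box_dimension.
Context {R : realType} {T : metricType R}.
Implicit Types (X Y B : set T) (r d a : R).
Local Open Scope ereal_scope.

Lemma covering_number_ge0 X d : 0 <= covering_number X d.
Proof. by apply: le_ereal_inf_tmp => _ [m _ <-]; rewrite lee_fin. Qed.

Lemma covering_number_le X d (s : seq T) :
  (forall x, X x -> exists2 y, y \in s & (mdist x y <= d)%R) ->
  covering_number X d <= (size s)%:R%:E.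
Proof.
move=> Xs; apply: ereal_inf_lbound; exists (size s) => //.
exists (fun i => tnth (in_tuple s) i) => x /Xs[y /(nthP y)[i si <-] xy].
by exists (Ordinal si); rewrite (tnth_nth y)/= metric_sym.
Qed.

Lemma covering_number_mono X Y d : X `<=` Y ->
  covering_number X d <= covering_number Y d.
Proof.
move=> XY; apply: ereal_inf_le_tmp => _ [m [c cY] <-]; exists m => //; exists c.
by move=> x /XY; exact: cY.
Qed.

Lemma upper_box_dim_ge0 X : 0 <= upper_box_dim X.
Proof. by apply: le_ereal_inf_tmp => _ [r [r0 _] <-]; rewrite lee_fin. Qed.

Lemma box_sum_ge0 X r d : 0 <= covering_number X d * (d `^ r)%:E.
Proof. by rewrite mule_ge0 ?covering_number_ge0// lee_fin powR_ge0. Qed.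

Lemma not_right0 : ~ (0 : R)%R^'+ set0.
Proof. by move=> h; have := @filter_not_empty _ _ (at_right_proper_filter (0:R)); apply. Qed.

Lemma upper_box_dim_mono X Y : X `<=` Y -> upper_box_dim X <= upper_box_dim Y.
Proof.
move=> XY; apply: ereal_inf_le_tmp => _ [r [r0 Yr] <-]; exists r => //; split => //.
apply/eqP; rewrite eq_le; apply/andP; split; last first.
  by apply: limf_esup_ge0; [exact: not_right0|exact: box_sum_ge0].
rewrite -Yr; apply: le_ereal_inf_tmp => _ [V V0 <-].
apply: ge_ereal_inf; exists (ereal_sup ((fun d : R => covering_number X d * (d `^ r)%:E) @` V)).
  by exists V.
apply: ge_ereal_sup => _ [d Vd <-]; apply: le_ereal_sup_tmp.
exists (covering_number Y d * (d `^ r)%:E); first by exists d.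
by rewrite lee_wpmul2r ?covering_number_mono// lee_fin powR_ge0.
Qed.

(** The exponent [r] of a bound on the covering numbers at all small scales
    bounds the upper box dimension. *)
Lemma upper_box_dim_le X r (C d0 : R) : (0 <= r)%R -> (0 < d0)%R ->
  (forall d, (0 < d)%R -> (d <= d0)%R ->
    covering_number X d <= (C * d `^ (- r))%:E) ->
  upper_box_dim X <= r%:E.
Proof.
move=> r0 d00 XC; apply/lee_addgt0Pr => e e0.
apply: ereal_inf_lbound; exists (r + e)%R => //; split; first by rewrite addr_ge0// ltW.
apply/eqP; rewrite eq_le; apply/andP; split; last first.
  by apply: limf_esup_ge0; [exact: not_right0|exact: box_sum_ge0].
apply/lee_addgt0Pr => h h0; rewrite add0e.
pose K := (`|C| + 1)%R.
have K0 : (0 < K)%R by rewrite ltr_wpDl.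
(* below the scale [d1], [K * d `^ e] is at most [h] *)
pose d1 := Num.min d0 ((h / K) `^ (e^-1))%R.
have d10 : (0 < d1)%R by rewrite lt_min d00 powR_gt0// divr_gt0.
apply: ge_ereal_inf; exists (ereal_sup ((fun d : R => covering_number X d * (d `^ (r + e))%:E) @`
    [set d | (0 < d)%R /\ (d < d1)%R])).
  exists [set d | (0 < d)%R /\ (d < d1)%R] => //.
  near=> d; split; first by near: d; exact: nbhs_right_gt.
  by near: d; exact: nbhs_right_lt.
apply: ge_ereal_sup => _ [d [dgt0 dd1] <-].
have /andP[dd0 dh] : ((d <= d0) && (d <= (h / K) `^ (e^-1)))%R.
  by move: (ltW dd1); rewrite /d1 le_min.
apply: (@le_trans _ _ ((C * d `^ (- r))%:E * (d `^ (r + e))%:E)).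
  by rewrite lee_wpmul2r ?XC// lee_fin powR_ge0.
rewrite -EFinM lee_fin -mulrA -powRD; last by rewrite (gt_eqF dgt0) implybT.
rewrite addKr.
have de : (d `^ e <= h / K)%R.
  apply: (@le_trans _ _ (((h / K) `^ e^-1) `^ e)%R).
    by apply: ge0_ler_powR => //; rewrite ?nnegrE ?powR_ge0 ?ltW.
  by rewrite -powRrM mulVf ?gt_eqF// powRr1// ltW// divr_gt0.
apply: (@le_trans _ _ (K * (h / K))%R); last by rewrite mulrCA divff ?gt_eqF// mulr1.
apply: (@le_trans _ _ (K * d `^ e)%R); last by rewrite ler_wpM2l// ltW.
rewrite ler_wpM2r ?powR_ge0// /K (le_trans (ler_norm C))// lerDl//.
Unshelve. all: by end_near. Qed.

Lemma upper_box_dim_cover X a : upper_box_dim X < a%:E ->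
  exists2 d0 : R, (0 < d0)%R & forall d, (0 < d)%R -> (d <= d0)%R ->
    exists p (c : 'I_p -> T), (forall x, X x -> exists i, (mdist (c i) x <= d)%R) /\
      (p%:R <= d `^ (- a))%R.
Proof.
move=> /ereal_inf_lt[_ [r [r0 Xr] <-]]; rewrite lte_fin => ra.
have : limf_esup (fun d : R => covering_number X d * (d `^ r)%:E) 0^'+ < 1.
  by rewrite Xr lte_fin.
move=> /ereal_inf_lt[_ [V V0 <-]] V1.
have [d1 /= d10 d1V] := V0.
exists (Num.min 1 (d1 / 2))%R; first by rewrite lt_min ltr01 divr_gt0.
move=> d d0; rewrite le_min => /andP[d1' dd1].
have Vd : V d.
  apply: d1V => //=; rewrite sub0r normrN gtr0_norm// (le_lt_trans dd1)//.
  by rewrite ltr_pdivrMr// mulr_natr mulr2n ltrDl.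
have : covering_number X d * (d `^ r)%:E < 1.
  by apply: le_lt_trans V1; apply: ereal_sup_ubound; exists d.
rewrite -lte_pdivlMr ?powR_gt0// mul1e -powRN => /ereal_inf_lt[_ [p [c cX] <-]].
rewrite lte_fin => pd; exists p, c; split => //.
by rewrite (le_trans (ltW pd))// ger_powR ?d0// lerN2 ltW.
Qed.

Lemma packing_dim_le X (B : (set T)^nat) (c : \bar R) :
  X = \bigcup_i B i -> (forall i, mbounded (B i)) ->
  (forall i, upper_box_dim (B i) <= c) -> packing_dim X <= c.
Proof.
move=> XB Bb Bc; apply: ge_ereal_inf.
exists (ereal_sup (range (fun i => upper_box_dim (B i)))); first by exists B.
by apply: ge_ereal_sup => _ [i _ <-].
Qed.

Lemma packing_dim_lt X (c : \bar R) : packing_dim X < c ->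
  exists2 B : (set T)^nat, X = \bigcup_i B i & forall i, upper_box_dim (B i) <= c.
Proof.
move=> /ereal_inf_lt[_ [B [_ XB] <-] Bc]; exists B => // i.
by apply: le_trans (ltW Bc); apply: ereal_sup_ubound; exists i.
Qed.

Lemma packing_dim_ge0 X : 0 <= packing_dim X.
Proof.
apply: le_ereal_inf_tmp => _ [B _ <-]; apply: le_ereal_sup_tmp.
by exists (upper_box_dim (B 0%N)); [exists 0%N|exact: upper_box_dim_ge0].
Qed.

End box_dimension.

(** * Orthogonal projections *)

Section projection_distance.
Context {R : realType} {n : nat}.
Implicit Types (V W : {vspace euclid R n}) (x y w : euclid R n).

Lemma enorm_le_coord x (c : R) : 0 <= c ->
  (forall j, `|(x : 'rV_n) 0 j| <= c) -> enorm x <= n%:R * c.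
Proof.
move=> c0 xc; rewrite -ler_sqr ?nnegrE ?enorm_ge0 ?mulr_ge0// enorm_sqr.
apply: (@le_trans _ _ (\sum_(j < n) c ^+ 2)).
  apply: ler_sum => j _; rewrite -expr2 -real_normK ?num_real//.
  by rewrite ler_sqr ?nnegrE.
rewrite sumr_const card_ord exprMn -[leLHS]mulr_natl ler_wpM2r ?sqr_ge0//.
by rewrite -natrX ler_nat; case: (n) => // m; rewrite leq_pmulr.
Qed.

Lemma normr_dotp_le x y : `|dotp x y| <= enorm x * enorm y.
Proof.
rewrite ler_norml dotp_le andbT lerNl -(enormN x) (le_trans _ (dotp_le _ _))//.
by rewrite linearNl.
Qed.

Lemma dotp_orthproj V x y : x \in V -> dotp x (orthproj V y) = dotp x y.
Proof.
move=> xV; apply/eqP; rewrite -subr_eq0 -linearBr/= -opprB linearNr oppr_eq0/=.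
by rewrite dotpC (orthprojP V y).2.
Qed.

Lemma enorm_sub_orthproj V x y : y \in V -> enorm (x - orthproj V x) <= enorm (x - y).
Proof.
move=> yV; have [pV xp] := orthprojP V x.
rewrite -ler_sqr ?nnegrE ?enorm_ge0// !enorm_sqr -(subrKA (orthproj V x) x (- y)).
rewrite [leRHS](@hnormDd _ _ _ _ (@dotp R n : {symmetric euclid R n}))/=.
  by rewrite lerDl dotp_ge0.
by apply: xp; rewrite memvB.
Qed.

(** The distance between two projections is controlled by the distance of the
    unit vectors of each subspace to the other one. The projection to [W] of a
    vector [q] orthogonal to [V] is estimated by moving the projection to the
    other side of the inner product. *)
Lemma opnorm_orthproj_le V W (eta : R) : 0 <= eta ->
  (forall x, x \in V -> enorm (x - orthproj W x) <= eta * enorm x) ->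
  (forall x, x \in W -> enorm (x - orthproj V x) <= eta * enorm x) ->
  opnorm (orthproj V - orthproj W) <= 2 * eta.
Proof.
move=> eta0 VW WV; apply: opnorm_le => x x1.
have [pV xp] := orthprojP V x.
set q := x - orthproj V x.
have q1 : enorm q <= 1.
  by rewrite (le_trans (enorm_sub_orthproj x (mem0v V)))// subr0.
have -> : (orthproj V - orthproj W)%VF x =
    (orthproj V x - orthproj W (orthproj V x)) - orthproj W q.
  by rewrite !lfunE/= !lfunE/= /q linearB/= opprB addrA addrNK.
rewrite (le_trans (enormD _ _))// enormN mulr2n mulrDl !mul1r lerD//.
  rewrite (le_trans (VW _ pV))// ler_piMr//.
  exact: le_trans (enorm_orthproj V x) x1.
have [rW _] := orthprojP W q.
have [r0|r0] := eqVneq (orthproj W q) 0; first by rewrite r0 enorm0.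
have r_gt0 : 0 < enorm (orthproj W q).
  by rewrite lt_def enorm_ge0 andbT; apply: contra r0 => /eqP/enorm_eq0 ->.
rewrite -(ler_pM2r r_gt0) -expr2 enorm_sqr dotp_orthproj//.
have -> : dotp (orthproj W q) q =
    dotp (orthproj W q - orthproj V (orthproj W q)) q.
  rewrite [in RHS]linearBl/= [X in _ - X]dotpC [X in _ - X]xp ?subr0//.
  exact: (orthprojP _ _).1.
rewrite (le_trans (dotp_le _ _))// (le_trans (ler_piMr _ q1)) ?enorm_ge0//.
exact: WV.
Qed.

End projection_distance.

(** * Charts of the Grassmannian *)

Section grassmannian_charts.
Context {R : realType} {n k : nat}.
Implicit Types (V W : grassmannian R n k) (f : {ffun 'I_k -> 'I_n}) (M : 'M[R]_(k, n)).

(** If the columns [f] of [M] form the identity matrix, replacing the [i]-th of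
    them by the column [j] of [M] gives a matrix of determinant [M i j]: the
    cofactors along that column are those of the identity. *)
Lemma det_id_col f (i : 'I_k) (j : 'I_n) M :
  (forall a l, M a (f l) = (a == l)%:R) ->
  \det (colsub [ffun l => if l == i then j else f l] M) = M i j.
Proof.
move=> Mf; set D := colsub _ M.
have cofD a : cofactor D a i = (1%:M : 'M[R]_k) i a.
  rewrite -[in RHS](adj1 R k) mxE /cofactor; congr (_ * \det _).
  apply/matrixP => u v; rewrite !mxE ffunE eq_sym (negbTE (neq_lift _ _)).
  exact: Mf.
rewrite (expand_det_col D i) (bigD1 i)//= big1 => [|a ai].
  by rewrite cofD !mxE eqxx mulr1 ffunE eqxx addr0.
by rewrite cofD !mxE eq_sym (negbTE ai) mulr0.
Qed.

(** The rows of [M] span [V] and have entries in [-1, 1], and the columns [f] of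
    [M] form the identity matrix: [V] is the graph of a linear map from the
    coordinates in the image of [f] to the others. *)
Definition chart_of V f M :=
  [/\ forall i, (row i M : euclid R n) \in grass_space V,
      forall x, x \in grass_space V ->
        x = \sum_i (x : 'rV_n) 0 (f i) *: (row i M : euclid R n),
      forall i l, M i (f l) = (i == l)%:R &
      forall i j, `|M i j| <= 1].

(** Choose the columns [f] so that the minor of a basis of [V] on them is maximal
    in absolute value, and normalise that minor to the identity; by [det_id_col]
    every entry is then a quotient of two minors, the larger one in the
    denominator. *)
Lemma exists_chart V : exists fM, chart_of V fM.1 fM.2.
Proof.
case: V => V /= /[dup] /eqP dimV dimk; rewrite /chart_of/=.
pose B : 'M[R]_(k, n) := \matrix_i (vbasis V)`_i.
have rowB i : row i B = (vbasis V)`_i by rewrite rowK.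
have VB x : x \in V -> exists u : 'rV[R]_k, x = u *m B.
  move: (B) rowB; move: {dimk B} dimV => <- B rowB xV.
  exists (\row_i coord (vbasis V) i x); rewrite mulmx_sum_row {1}(coord_vbasis xV).
  by apply: eq_bigr => i _; rewrite rowB mxE.
have BV i : (row i B : euclid R n) \in V.
  by rewrite rowB vbasis_mem// mem_nth// size_tuple dimV.
have freeB : row_free B.
  move: (B) rowB; move: {dimk B VB BV} dimV => <- B rowB.
  rewrite -kermx_eq0; apply/eqP/row_matrixP => l; rewrite row0.
  set u := row l _; have : u *m B = 0 by apply/sub_kermxP; rewrite row_sub.
  rewrite mulmx_sum_row => uB.
  have /freeP : free (vbasis V) := basis_free (vbasisP V).
  move=> /(_ (fun i => u 0 i)) h; apply/rowP => i; rewrite [RHS]mxE; apply: h.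
  by rewrite -[RHS]uB; apply: eq_bigr => j _; rewrite rowB.
have fullB : row_full B^T by rewrite /row_full mxrank_tr.
pose f0 : {ffun 'I_k -> 'I_n} := finfun (fullrankfun fullB).
have detf0 : \det (colsub f0 B) != 0.
  rewrite -unitfE -unitmxE -unitmx_tr trmx_mxsub.
  by rewrite (eq_rowsub _ (ffunE _)) fullrowsub_unit.
pose F (f : {ffun 'I_k -> 'I_n}) := `|\det (colsub f B)|.
have [f _ fmax] := @Num.Theory.real_arg_maxP R _ f0 predT F isT (fun f _ => num_real (F f)).
have detf : \det (colsub f B) != 0.
  by rewrite -normr_gt0 (lt_le_trans _ (fmax f0 isT))// normr_gt0.
have unitf : colsub f B \in unitmx by rewrite unitmxE unitfE.
pose M := invmx (colsub f B) *m B.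
have Mf i l : M i (f l) = (i == l)%:R.
  have : colsub f M = 1%:M by rewrite -mulmx_colsub mulVmx.
  by move=> /matrixP/(_ i l); rewrite !mxE.
have BM : B = colsub f B *m M by rewrite mulKVmx.
exists (f, M); split => //=.
- move=> i; rewrite row_mul mulmx_sum_row; apply: rpred_sum => l _.
  exact: rpredZ.
- move=> x /VB[u ->]; rewrite BM mulmxA; set v := u *m _.
  rewrite [LHS]mulmx_sum_row; apply: eq_bigr => i _; congr (_ *: _).
  rewrite [RHS]mxE (bigD1 i)//= big1 => [|l li]; first by rewrite Mf eqxx mulr1 addr0.
  by rewrite Mf (negbTE li) mulr0.
- move=> i j; rewrite -(det_id_col _ _ Mf); set f' := finfun _.
  have : F f' <= F f by exact: fmax.
  by rewrite /F {1}BM -mulmx_colsub det_mulmx normrM ger_pMr// normr_gt0.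
Qed.

Lemma chart_inj V f M : chart_of V f M -> injective f.
Proof.
move=> [_ _ Mf _] i l fil; have := Mf i i; rewrite fil Mf eqxx.
by case: eqVneq => // _ /eqP; rewrite eq_sym oner_eq0.
Qed.

(** In the chart given by the columns [f], a subspace depends on its matrix in a
    Lipschitz way. *)
Lemma chart_dist V W f M M' (eta : R) : chart_of V f M -> chart_of W f M' ->
  0 <= eta -> (forall i j, `|M i j - M' i j| <= eta) ->
  mdist V W <= 2 * (n%:R * (k%:R * eta)).
Proof.
move=> VM WM' eta0 MM'; rewrite grassmannian_mdistE.
suff H X Y N N' : chart_of X f N -> chart_of Y f N' ->
    (forall i j, `|N i j - N' i j| <= eta) -> forall x, x \in grass_space X ->
    enorm (x - orthproj Y x) <= n%:R * (k%:R * eta) * enorm x.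
  apply: opnorm_orthproj_le; first by rewrite !mulr_ge0.
    exact: (H _ _ _ _ VM WM').
  by apply: (H _ _ _ _ WM' VM) => i j; rewrite distrC.
move=> [_ XN _ _] [YN' _ _ _] NN' x xX.
pose y : euclid R n := \sum_i (x : 'rV_n) 0 (f i) *: (row i N' : euclid R n).
have yY : y \in grass_space Y by apply: rpred_sum => i _; exact: rpredZ.
rewrite (le_trans (enorm_sub_orthproj x yY))// -mulrA.
apply: enorm_le_coord; first by rewrite !mulr_ge0 ?enorm_ge0.
move=> j; rewrite {1}(XN x xX) /y -sumrB summxE.
rewrite (le_trans (ler_norm_sum _ _ _))//.
apply: (@le_trans _ _ (\sum_(i < k) eta * enorm x)); last first.
  by rewrite sumr_const card_ord -[leLHS]mulr_natl mulrA.
apply: ler_sum => i _; rewrite !mxE -mulrBr normrM mulrC ler_pM//.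
exact: le_coord_enorm.
Qed.

End grassmannian_charts.

(** * Subspaces almost orthogonal to a given vector *)

Section near_orthogonal.
Context {R : realType} {n k : nat}.
Implicit Types (V W : grassmannian R n k) (f : {ffun 'I_k -> 'I_n}).
Implicit Types (M : 'M[R]_(k, n)) (w : euclid R n).

Lemma chart_rowdot V f M w (e : R) : chart_of V f M ->
  enorm (orthproj V w) <= e ->
  forall i, `|\sum_j M i j * (w : 'rV_n) 0 j| <= n%:R * e.
Proof.
move=> [MV _ _ M1] we i.
have -> : \sum_j M i j * (w : 'rV_n) 0 j = dotp (row i M : euclid R n) w.
  by apply: eq_bigr => j _; rewrite mxE.
rewrite -(dotp_orthproj _ (MV i)) (le_trans (normr_dotp_le _ _))//.
rewrite ler_pM ?enorm_ge0//.
rewrite -[leRHS]mulr1; apply: enorm_le_coord => // j; rewrite mxE.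
exact: M1.
Qed.

(** If [V] is almost orthogonal to [w], then [w] cannot be concentrated on the
    coordinates in the image of [f]: the coordinate [j0], the largest of the
    others, is comparable to the norm of [w] up to the error [e]. *)
Lemma chart_pivot_ge V f M w (j0 : 'I_n) (e : R) : chart_of V f M ->
  enorm (orthproj V w) <= e -> 0 <= e ->
  (forall j, j \notin codom f -> `|(w : 'rV_n) 0 j| <= `|(w : 'rV_n) 0 j0|) ->
  enorm w <= n%:R * (n%:R * e + n%:R * `|(w : 'rV_n) 0 j0|).
Proof.
move=> VM we e0 j0max; set m := `|(w : 'rV_n) 0 j0|.
have m0 : 0 <= m by rewrite normr_ge0.
apply: enorm_le_coord; first by rewrite addr_ge0// mulr_ge0.
move=> j; have n1 : 1 <= n%:R :> R by rewrite ler1n (leq_ltn_trans _ (ltn_ord j)).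
have [/codomP[i ->]|/j0max jm] := boolP (j \in codom f); last first.
  by rewrite (le_trans jm)// ler_wpDl ?mulr_ge0// ler_peMl.
have := chart_rowdot VM we i; case: VM => _ _ Mf M1.
rewrite (bigD1 (f i))//= Mf eqxx mul1r => h.
set S := \sum_(_ < _ | _) _ in h.
have Sm : `|S| <= n%:R * m.
  rewrite (le_trans (ler_norm_sum _ _ _))//.
  apply: (@le_trans _ _ (\sum_(j < n) m)); last by rewrite sumr_const card_ord mulr_natl.
  rewrite [leLHS]big_mkcond; apply: ler_sum => l _; case: ifP => // lfi.
  have [/codomP[i' li']|/j0max lm] := boolP (l \in codom f).
    rewrite li' Mf; case: eqVneq => [ii'|_]; last by rewrite mul0r normr0.
    by rewrite li' ii' eqxx in lfi.
  by rewrite normrM (le_trans (ler_pM _ _ (M1 _ _) lm))// mul1r.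
have -> : (w : 'rV_n) 0 (f i) = ((w : 'rV_n) 0 (f i) + S) - S by rewrite addrK.
by rewrite (le_trans (ler_normB _ _))// lerD.
Qed.

(** Near-orthogonality to [w] is one linear equation on each row of the matrix; it
    determines the entry in the pivot column [j0] from the others. *)
Lemma chart_close (f : {ffun 'I_k -> 'I_n}) M M' w (j0 : 'I_n) (d e c : R) :
  (forall i l, M i (f l) = (i == l)%:R) -> (forall i l, M' i (f l) = (i == l)%:R) ->
  (forall j, j \notin codom f -> `|(w : 'rV_n) 0 j| <= `|(w : 'rV_n) 0 j0|) ->
  0 <= d -> 0 < c -> c <= `|(w : 'rV_n) 0 j0| ->
  (forall i, `|\sum_j M i j * (w : 'rV_n) 0 j| <= e) ->
  (forall i, `|\sum_j M' i j * (w : 'rV_n) 0 j| <= e) ->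
  (forall i j, j \notin codom f -> j != j0 -> `|M i j - M' i j| <= d) ->
  forall i j, `|M i j - M' i j| <= n%:R * d + 2 * e / c.
Proof.
move=> Mf M'f j0max d0 c0 cw Me M'e MM' i j.
have e0 : 0 <= e by exact: le_trans (Me i).
have n1 : 1 <= n%:R :> R by rewrite ler1n (leq_ltn_trans _ (ltn_ord j)).
have [/codomP[l ->]|jf] := boolP (j \in codom f).
  by rewrite Mf M'f subrr normr0 addr_ge0 ?mulr_ge0// invr_ge0 ltW.
have [->{j jf}|jj0] := eqVneq j j0; last first.
  rewrite (le_trans (MM' i j jf jj0))// ler_wpDr ?ler_peMl//.
  by rewrite !mulr_ge0// invr_ge0 ltW.
set m := `|(w : 'rV_n) 0 j0| in cw j0max.
have m0 : 0 < m by exact: lt_le_trans cw.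
have hS : (M i j0 - M' i j0) * (w : 'rV_n) 0 j0 =
    \sum_j M i j * (w : 'rV_n) 0 j - \sum_j M' i j * (w : 'rV_n) 0 j
    - \sum_(j | j != j0) (M i j - M' i j) * (w : 'rV_n) 0 j.
  rewrite -sumrB (eq_bigr (fun j => (M i j - M' i j) * (w : 'rV_n) 0 j)); last first.
    by move=> l _; rewrite mulrBl.
  by rewrite (bigD1 j0)//= addrK.
rewrite -(ler_pM2r m0) -[X in X <= _]normrM hS.
have hrest : `|\sum_(j | j != j0) (M i j - M' i j) * (w : 'rV_n) 0 j| <= n%:R * d * m.
  rewrite (le_trans (ler_norm_sum _ _ _))//.
  apply: (@le_trans _ _ (\sum_(j < n) d * m)).
    rewrite [leLHS]big_mkcond; apply: ler_sum => l _; case: ifP => [lj0|_]; last first.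
      by rewrite mulr_ge0// ltW.
    have [/codomP[i' ->]|lf] := boolP (l \in codom f).
      by rewrite Mf M'f subrr mul0r normr0 mulr_ge0// ltW.
    by rewrite normrM ler_pM// ?MM'// j0max.
  by rewrite sumr_const card_ord -[leLHS]mulr_natl mulrA.
rewrite (le_trans (ler_normB _ _))// mulrDl addrC lerD//.
rewrite (le_trans (ler_normB _ _))//.
apply: (@le_trans _ _ (e + e)); first by rewrite lerD.
rewrite -mulr2n -[leLHS]mulr_natl -[leRHS]mulrA ler_peMr ?mulr_ge0//.
by rewrite mulrC ler_pdivlMr// mul1r.
Qed.

Lemma exists_pivot f w : (k < n)%N -> injective f -> exists2 j0, j0 \notin codom f &
  forall j, j \notin codom f -> `|(w : 'rV_n) 0 j| <= `|(w : 'rV_n) 0 j0|.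
Proof.
move=> kn finj.
have [j1 j1f] : exists j1, j1 \notin codom f.
  apply/existsP; rewrite -negb_forall; apply/negP => /forallP h.
  move: kn; rewrite ltnNge; apply/negP; rewrite negbK.
  rewrite -{1}(card_ord n) -[leqRHS]card_ord -(card_codom finj).
  by apply: subset_leq_card; apply/fintype.subsetP => j _; exact: h.
have [j0 j0f j0max] := @Num.Theory.real_arg_maxP R _ j1 (fun j => j \notin codom f)
  (fun j => `|(w : 'rV_n) 0 j|) j1f (fun j _ => num_real _).
by exists j0.
Qed.

Lemma card_free_coords f (j0 : 'I_n) : injective f -> j0 \notin codom f ->
  #|[predD1 [predC codom f] & j0]| = (n - k - 1)%N.
Proof.
move=> finj j0f; have := cardD1 j0 [predC codom f]; rewrite inE j0f/= => h.
have := cardC (mem (codom f)); rewrite (card_codom finj) !card_ord => kn.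
by rewrite -[X in (X - k)%N]kn addKn h add1n subn1.
Qed.

(** The [k]-dimensional subspaces almost orthogonal to a vector [w] behave like a
    set of dimension [k * (n - k - 1)]. A subspace is coded by its chart and by
    the positions, in a grid of mesh [d], of its free matrix entries outside the
    pivot column; two subspaces with the same code are at distance at most
    [C * d]. *)
Lemma spaced_near_orthogonal (c : R) : (k < n)%N -> 0 < c ->
  exists C K d0 : R, [/\ 0 < C, 0 <= K, 0 < d0 &
    forall d, 0 < d -> d <= d0 -> forall w : euclid R n, c <= enorm w ->
    forall s : seq (grassmannian R n k), spaced (C * d) s ->
    (forall V, V \in s -> enorm (orthproj V w) <= 2 * d) ->
    (size s)%:R <= K * (d^-1) ^+ (k * (n - k - 1))].
Proof.
move=> kn c0.
have n0 : 0 < n%:R :> R by rewrite ltr0n (leq_ltn_trans _ kn).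
(* lower bound on the pivot coordinate *)
pose c1 : R := c / (2 * n%:R ^+ 2).
have c10 : 0 < c1 by rewrite divr_gt0// mulr_gt0// exprn_gt0.
(* [E * d] bounds the difference of the entries of two matrices with equal code *)
pose E : R := n%:R + 2 * (n%:R * 2) / c1.
have E0 : 0 <= E by rewrite addr_ge0 ?divr_ge0 ?mulr_ge0// ltW.
pose C : R := 2 * (n%:R * (k%:R * E)) + 1.
have C0 : 0 < C by rewrite ltr_wpDl// !mulr_ge0// ltW.
pose m := (k * (n - k - 1))%N.
pose K : R := #|{ffun 'I_k -> 'I_n}|%:R * 3 ^+ m.
exists C, K, (Num.min 1 (c / (4 * n%:R ^+ 2))); split => //.
- by rewrite mulr_ge0// exprn_ge0.
- by rewrite lt_min ltr01 divr_gt0// mulr_gt0// exprn_gt0.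
move=> d dgt0; rewrite le_min => /andP[d1 dc] w cw s sC sw.
have [fM fMP] := choice (@exists_chart R n k).
have finj V : injective (fM V).1 by exact: chart_inj (fMP V).
(* the pivot depends on the columns of the chart only *)
have /choice[pv pvP] : forall f, exists j0, injective f -> j0 \notin codom f /\
    forall j, j \notin codom f -> `|(w : 'rV_n) 0 j| <= `|(w : 'rV_n) 0 j0|.
  move=> f; have [finjf|nf] := pselect (injective f); last by exists (Ordinal kn).
  by have [j0 ? ?] := exists_pivot w kn finjf; exists j0.
(* the entries are shifted by 1, so as to round numbers in [0, 2 / d] *)
pose Q := Num.truncn (2 / d).
pose D f : pred 'I_n := [predD1 [predC codom f] & pv f].
pose grid V i j := Num.truncn (((fM V).2 i j + 1) / d).
pose code V : {ffun 'I_k * 'I_(n - k - 1) -> 'I_Q.+1} :=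
  [ffun p : 'I_k * 'I_(n - k - 1) =>
    inord (grid V p.1 (nth (pv (fM V).1) (enum (D (fM V).1)) p.2))].
pose label V := ((fM V).1, code V).
have grid_arg V i j : 0 <= ((fM V).2 i j + 1) / d <= 2 / d.
  have [_ _ _ /(_ i j)] := fMP V; rewrite ler_norml => /andP[h1 h2].
  rewrite divr_ge0 ?(ltW dgt0)//=; last by rewrite -lerBlDr sub0r.
  by rewrite ler_pM2r ?invr_gt0//; lra.
have gridQ V i j : (grid V i j < Q.+1)%N.
  by rewrite ltnS; apply: le_truncn; case/andP: (grid_arg V i j).
have label_inj : {in s &, injective label}.
  move=> V W Vs Ws [fVW cVW]; apply/eqP; apply: contraT => VW.
  have := pairwise_spaced sC Vs Ws VW; rewrite ltNge; apply: contraNT => _.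
  have WMP := fMP W; rewrite -fVW in WMP.
  have [j0f j0max] := pvP _ (finj V).
  have c1w : c1 <= `|(w : 'rV_n) 0 (pv (fM V).1)|.
    have := chart_pivot_ge (fMP V) (sw _ Vs) _ j0max.
    set m0 := `|_|; have d20 : 0 <= 2 * d by rewrite mulr_ge0// ltW.
    move=> /(_ d20)/(le_trans cw) h.
    rewrite /c1 ler_pdivrMr ?mulr_gt0 ?exprn_gt0//.
    move: dc; rewrite ler_pdivlMr ?mulr_gt0 ?exprn_gt0// => dc.
    by move: h dc; set nn := n%:R; clear; move=> *; nra.
  have dist : mdist V W <= 2 * (n%:R * (k%:R * (n%:R * d + 2 * (n%:R * (2 * d)) / c1))).
    apply: (chart_dist (fMP V) WMP).
      by rewrite addr_ge0 ?divr_ge0//; do ?[exact: ltW|apply: mulr_ge0 => //].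
    apply: (@chart_close (fM V).1 _ _ w (pv (fM V).1)) => //.
    - by case: (fMP V).
    - by case: WMP.
    - exact: ltW.
    - exact: chart_rowdot (fMP V) (sw _ Vs).
    - exact: chart_rowdot WMP (sw _ Ws).
    move=> i j jf jj0.
    have jD : j \in enum (D (fM V).1) by rewrite mem_enum !inE jj0.
    have ij : (index j (enum (D (fM V).1)) < n - k - 1)%N.
      by rewrite -(card_free_coords (finj V) j0f) cardE index_mem.
    have /ffunP/(_ (i, Ordinal ij)) := cVW.
    rewrite !ffunE/= -fVW nth_index// => /(congr1 val); rewrite /= !inordK//.
    move=> /truncn_inj_dist h.
    have {}h := h (andP (grid_arg V i j)).1 (andP (grid_arg W i j)).1.
    rewrite -mulrBl (_ : _ + 1 - _ = (fM V).2 i j - (fM W).2 i j) in h; last by ring.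
    by rewrite normrM (gtr0_norm (_ : 0 < d^-1)) ?invr_gt0// ler_pdivrMr// mul1r in h.
  rewrite (le_trans dist)// [leLHS](_ : _ = 2 * (n%:R * (k%:R * E)) * d); last first.
    by rewrite /E; ring.
  by rewrite ler_wpM2r ?(ltW dgt0)// lerDl.
have su : uniq s by apply: spaced_uniq sC; rewrite mulr_ge0// ltW.
have -> : size s = size (map label s) by rewrite size_map.
have ul : uniq (map label s) by rewrite map_inj_in_uniq.
rewrite -(card_uniqP ul).
apply: (@le_trans _ _ #|{: {ffun 'I_k -> 'I_n} * {ffun 'I_k * 'I_(n - k - 1) -> 'I_Q.+1}}|%:R).
  by rewrite ler_nat max_card.
rewrite card_prod natrM /K -mulrA ler_wpM2l// card_ffun card_prod !card_ord natrX -exprMn.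
rewrite lerXn2r ?nnegrE ?mulr_ge0 ?invr_ge0 ?(ltW dgt0)//.
have Qd : Q%:R <= 2 / d by rewrite truncn_le divr_ge0 ?(ltW dgt0).
rewrite -natr1 (le_trans (lerD Qd (lexx _)))//.
rewrite [leRHS](_ : _ = 2 / d + d^-1); last by ring.
by rewrite lerD2l invf_ge1.
Qed.

End near_orthogonal.

(** * Pairs of balls with close projections *)

Section pair_counting.
Context {R : realType} {n k : nat}.
Implicit Types (V W : grassmannian R n k) (A Y : set (euclid R n)) (x y : euclid R n).

(** Pairs of points of [a] at distance at least [c] whose projections to [V] are at
    distance at most [2 * d]. *)
Definition near_pairs V (c d : R) p (a : 'I_p -> euclid R n) : pred ('I_p * 'I_p) :=
  [pred ij | (c <= enorm (a ij.1 - a ij.2)) &&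
             (enorm (orthproj V (a ij.1 - a ij.2)) <= 2 * d)].

(** The part of [A] in the affine subspace orthogonal to [V] through [y]. *)
Definition fibre V A y := A `&` orthproj V @^-1` [set y].

Section fixed_cover.
Context (V : grassmannian R n k) (A Y : set (euclid R n)).
Context (sg b2 rho d c : R) (p : nat) (a : 'I_p -> euclid R n).
Context (sg0 : 0 < sg).
Context (b20 : 0 < b2).
Context (rho0 : 0 < rho).
Context (rho_sg : (2 * rho) `^ sg <= b2 / 2).
Context (d0 : 0 < d).
Context (drho : d <= rho / 2).
Context (crho : c <= rho / 2).
Context (Aa : forall x, A x -> exists i, mdist (a i) x <= d).
Context (Yb2 : forall y, Y y -> (b2%:E <= hausdorff_content sg (fibre V A y))%E).

(* the balls that meet the fibre over [y] *)
Let hit y : pred 'I_p := fun i => `[< exists2 x, fibre V A y x & mdist (a i) x <= d >].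

(* those of them that are not too close to the ball [i] *)
Let far y i : pred 'I_p := [pred j | hit y j && (c <= enorm (a i - a j))].

Let q := b2 / 2 / (2 * d) `^ sg.

Lemma hit_proj y i : hit y i -> mdist (orthproj V (a i)) y <= d.
Proof.
move=> /asboolP[x [_ /= <-] aix]; rewrite (le_trans _ aix)// !euclid_mdistE.
by rewrite -linearB enorm_orthproj.
Qed.

Lemma hit_inj y y' i : hit y i -> hit y' i -> mdist y y' <= 2 * d.
Proof.
move=> /hit_proj h /hit_proj h'.
rewrite (le_trans (metric_triangle _ (orthproj V (a i)) _))// (metric_sym y).
by rewrite mulr2n mulrDl mul1r lerD.
Qed.

Lemma exists_hit y : Y y -> exists i, hit y i.
Proof.
move=> Yy; have [[x fx]|nf] := pselect (fibre V A y !=set0).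
  by have [i aix] := Aa fx.1; exists i; apply/asboolP; exists x.
have := Yb2 Yy; rewrite leNgt (le_lt_trans (@hausdorff_content_cover _ _ sg _ [::] _))//.
  by move=> x fx; case: nf; exists x.
by rewrite big_nil lte_fin.
Qed.

(** The fibre cannot be exhausted by the ball of radius [rho] around [a i], which
    accounts for at most half of the bound [b2] on its content; the rest is
    covered by the balls of [far y i]. *)
Lemma far_card y i : Y y -> hit y i -> q <= #|far y i|%:R.
Proof.
move=> Yy yi; rewrite /q ler_pdivrMr ?powR_gt0 ?mulr_gt0//.
have := Yb2 Yy.
set U := cball (a i) rho :: [seq cball (a j) d | j <- enum (far y i)].
have fU x : fibre V A y x -> exists2 B, B \in U & B x.
  move=> fx; have [aix|aix] := leP (mdist (a i) x) rho.
    by exists (cball (a i) rho) => //; rewrite inE eqxx.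
  have [j ajx] := Aa fx.1.
  exists (cball (a j) d) => //; rewrite inE; apply/orP; right; apply: map_f.
  rewrite mem_enum inE; apply/andP; split; first by apply/asboolP; exists x.
  have := metric_triangle (a i) (a j) x; rewrite -euclid_mdistE => h.
  by move: h aix ajx drho crho; lra.
move=> /le_trans/(_ (hausdorff_content_cover sg fU)).
rewrite big_cons big_map -[leRHS]/(_ + _)%E => h.
have : (b2%:E <= (b2 / 2)%:E + (#|far y i|%:R * (2 * d) `^ sg)%:E)%E.
  apply: (le_trans h); apply: leeD.
    by rewrite (le_trans (diam_pow_cball _ (ltW sg0) (ltW rho0)))// lee_fin.
  apply: (@le_trans _ _ (\sum_(j <- enum (far y i)) ((2 * d) `^ sg)%:E)%E).
    by apply: lee_sum => j _; apply: diam_pow_cball; exact: ltW.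
  by rewrite sumEFin lee_fin big_const_seq count_predT -cardE iter_addr_0 -[leLHS]mulr_natl.
by rewrite -EFinD lee_fin; lra.
Qed.

(** Each [y] of a spaced family contributes at least [q ^+ 2] pairs, and the balls
    that meet the fibres over two of these points are different. *)
Lemma near_pairs_ge (s : seq (euclid R n)) : (forall y, y \in s -> Y y) ->
  spaced (2 * d) s -> (size s)%:R * q ^+ 2 <= #|near_pairs V c d a|%:R.
Proof.
move=> sY ss.
have q0 : 0 <= q by rewrite /q divr_ge0 ?powR_ge0// divr_ge0// ltW.
have us : uniq s by apply: spaced_uniq ss; rewrite mulr_ge0// ltW.
have one y : Y y -> q ^+ 2 <= \sum_(i | hit y i) #|far y i|%:R.
  move=> Yy; have [i0 yi0] := exists_hit Yy.
  apply: (@le_trans _ _ (\sum_(i | hit y i) q)); last first.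
    by apply: ler_sum => i; exact: far_card.
  rewrite sumr_const expr2 -mulr_natl ler_wpM2r// (le_trans (far_card Yy yi0))//.
  by rewrite ler_nat; apply: subset_leq_card; apply/fintype.subsetP => j; rewrite inE => /andP[].
apply: (@le_trans _ _ (\sum_(y <- s) \sum_(i | hit y i) #|far y i|%:R)).
  rewrite (_ : (size s)%:R * _ = \sum_(y <- s) q ^+ 2); last first.
    by rewrite big_const_seq count_predT iter_addr_0 -[RHS]mulr_natl.
  by rewrite big_seq [leRHS]big_seq; apply: ler_sum => y /sY; exact: one.
rewrite (eq_bigr (fun y => \sum_i (if hit y i then #|far y i|%:R else 0))); last first.
  by move=> y _; rewrite big_mkcond.
rewrite exchange_big/=.
have -> : #|near_pairs V c d a|%:R = \sum_i \sum_j (near_pairs V c d a (i, j))%:R :> R.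
  rewrite -sum1_card natr_sum big_mkcond/= pair_big/=.
  by apply: eq_bigr => -[i j] _; rewrite -[_ \in _]/(near_pairs V c d a (i, j));
    case: (near_pairs V c d a (i, j)).
apply: ler_sum => i _.
have [[y0 y0s y0i]|no] := pselect (exists2 y, y \in s & hit y i); last first.
  rewrite big_seq big1 ?sumr_ge0// => y ys; case: ifP => // yi.
  by case: no; exists y.
rewrite (bigD1_seq y0)//= y0i [X in _ + X]big_seq_cond [X in _ + X]big1 ?addr0; last first.
  move=> y /andP[ys yy0]; case: ifP => // yi; have := hit_inj yi y0i.
  by rewrite leNgt (pairwise_spaced ss ys y0s yy0).
rewrite -sum1_card natr_sum big_mkcond/=; apply: ler_sum => j _.
rewrite -[j \in _]/(far y0 i j) /far/=; case: ifP => [/andP[yj cij]|_]; last by rewrite ler0n.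
rewrite /near_pairs/= cij linearB/= -euclid_mdistE (_ : _ <= _)//.
rewrite (le_trans (metric_triangle _ y0 _))// [mdist y0 _]metric_sym.
by rewrite mulr2n mulrDl mul1r lerD// hit_proj.
Qed.

(** Distinct members of the family have fibres that meet different balls. *)
Lemma spaced_size_le (s : seq (euclid R n)) : (forall y, y \in s -> Y y) ->
  spaced (2 * d) s -> (size s <= p.+1)%N.
Proof.
move=> sY ss; have us : uniq s by apply: spaced_uniq ss; rewrite mulr_ge0// ltW.
(* points outside [Y] are sent to [None], whence the bound [p.+1] *)
have /choice[g gP] : forall y, exists i : option 'I_p, Y y -> exists2 j, i = Some j & hit y j.
  move=> y; have [Yy|nY] := pselect (Y y); last by exists None.
  by have [i yi] := exists_hit Yy; exists (Some i) => _; exists i.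
have ginj : {in s &, injective g}.
  move=> y y' ys y's gyy'; apply/eqP; apply: contraT => yy'.
  have [j gj yj] := gP _ (sY _ ys); have [j' gj' yj'] := gP _ (sY _ y's).
  have jj' : j = j' by apply: Some_inj; rewrite -gj -gj'.
  rewrite -jj' in yj'; have := hit_inj yj yj'.
  by rewrite leNgt (pairwise_spaced ss ys y's yy').
rewrite -(size_map g) -[in leqRHS](card_ord p) -card_option.
by rewrite -(card_uniqP _) ?max_card// map_inj_in_uniq.
Qed.

End fixed_cover.

(** If the fibres over [Y] have dimension [sg] and [Y] has dimension [tau], in the
    sense of uniform lower bounds, then every cover of [A] by balls of radius [d]
    has at least about [d `^ (- (2 * sg + tau))] pairs with close projections. *)
Lemma near_pairs_lower V A Y (sg tau b1 b2 : R) : 0 < sg -> 0 < b1 -> 0 < b2 ->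
  (forall d, 0 < d -> d <= 1 -> forall s : seq (euclid R n),
    (forall y, Y y -> exists2 z, z \in s & mdist y z <= d) ->
    b1 <= (size s)%:R * d `^ tau) ->
  (forall y, Y y -> (b2%:E <= hausdorff_content sg (fibre V A y))%E) ->
  exists c b, [/\ 0 < c, 0 < b & forall d, 0 < d -> d <= c ->
    forall p (a : 'I_p -> euclid R n), (forall x, A x -> exists i, mdist (a i) x <= d) ->
    b * d `^ (- (2 * sg + tau)) <= #|near_pairs V c d a|%:R].
Proof.
move=> sg0 b10 b20 Yb1 Yb2.
(* chosen so that [(2 * rho) `^ sg = b2 / 2] *)
pose rho := (b2 / 2) `^ sg^-1 / 2.
have b220 : 0 < b2 / 2 by rewrite divr_gt0.
have rho0 : 0 < rho by rewrite divr_gt0// powR_gt0.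
have rho_sg : (2 * rho) `^ sg <= b2 / 2.
  rewrite /rho mulrC divfK// -powRrM mulVf ?gt_eqF// powRr1// ltW//.
pose c := Num.min 2^-1 (rho / 2).
have c0 : 0 < c by rewrite lt_min invr_gt0 ltr0n/= divr_gt0.
have crho : c <= rho / 2 by rewrite ge_min lexx orbT.
have c2 : c <= 2^-1 by rewrite ge_min lexx.
pose b := (b2 / 2) ^+ 2 * b1 * 2 `^ (- (2 * sg + tau)).
exists c, b; split => //; first by rewrite !mulr_gt0// powR_gt0.
move=> d d0 dc p a Aa.
have drho : d <= rho / 2 by rewrite (le_trans dc).
have d20 : 0 < 2 * d by rewrite mulr_gt0.
have d21 : 2 * d <= 1 by move: dc c2; lra.
have [s [sY ss Ys]] := maximal_spaced (spaced_size_le b20 d0 Aa Yb2).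
have sb1 := Yb1 _ d20 d21 s Ys.
apply: le_trans (near_pairs_ge sg0 b20 rho0 rho_sg d0 drho crho Aa Yb2 sY ss).
have -> : b * d `^ (- (2 * sg + tau)) = b1 * (2 * d) `^ (- tau) * (b2 / 2 / (2 * d) `^ sg) ^+ 2.
  rewrite /b -[LHS]mulrA -powRM// ?(ltW d0)//; set D := 2 * d in d20 *.
  rewrite [RHS](_ : _ = (b2 / 2) ^+ 2 * b1 * (D `^ (- tau) * (D `^ (- sg)) ^+ 2)); last first.
    by rewrite (powRN _ sg); ring.
  rewrite -[(D `^ (- sg)) ^+ 2]powR_mulrn ?powR_ge0// -powRrM -powRD; last first.
    by rewrite (gt_eqF d20) implybT.
  by congr (_ * _ `^ _); ring.
rewrite ler_wpM2r ?sqr_ge0//.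
by rewrite powRN ler_pdivrMr ?powR_gt0.
Qed.

(** Every cover of [A] by balls of small radius [d] has at least about
    [d `^ (- kappa)] well-separated pairs whose projections to [V] are close. All
    constants are expressed by the single integer [N], so that [V] varies over
    countably many classes. *)
Definition rich A (kappa : R) (N : nat) V := forall d : R, 0 < d -> d <= N.+1%:R^-1 ->
  forall p (a : 'I_p -> euclid R n), (forall x, A x -> exists i, mdist (a i) x <= d) ->
  N.+1%:R^-1 * d `^ (- kappa) <= #|near_pairs V N.+1%:R^-1 d a|%:R.

(** Dimension conservation gives [Delta], a set [Y] of dimension at least
    [alpha - Delta], and fibres over [Y] of dimension about [Delta]; moreover
    [Delta >= alpha - s] as [Y] lies in a set of dimension at most [s]. The
    exponent [2 * sg + tau] of the number of pairs is thus about
    [alpha + Delta >= 2 * alpha - s]. *)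
Lemma adc_rich V A (alpha s e : R) : almost_dim_conserving (orthproj V) A ->
  hausdorff_dim A = alpha%:E -> (hausdorff_dim (orthproj V @` A) <= s%:E)%E ->
  0 < e -> 4 * e < alpha - s ->
  exists N, rich A (2 * alpha - s - 5 * e) N V.
Proof.
move=> [_ [Delta _ adc]] Aalpha As e0 es; have {adc} := adc e e0.
set Y := [set y | _]; rewrite Aalpha => alphaY.
have Ys : (hausdorff_dim Y <= s%:E)%E.
  by apply: le_trans As; apply: hausdorff_dim_le => y [].
have [h Yh] : exists h, hausdorff_dim Y = h%:E.
  move: alphaY Ys; case: (hausdorff_dim Y) => [h _ _|_|]; first by exists h.
  - by rewrite leNgt ltey.
  - by rewrite addeNy leNgt ltNye.
have hs : h <= s by move: Ys; rewrite Yh lee_fin.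
have aDh : alpha <= Delta + h by move: alphaY; rewrite Yh -EFinD lee_fin.
pose sg := Delta - 2 * e; pose tau := h - e.
have sg0 : 0 < sg by rewrite /sg; lra.
have tauY : (tau%:E < hausdorff_dim Y)%E by rewrite Yh lte_fin /tau; lra.
have Y0 : Y !=set0.
  apply/set0P/eqP => Y0; move: Yh; rewrite Y0 /hausdorff_dim eqxx; by [].
(* uniform lower bounds on the content hold on the pieces [X m] *)
pose X (m : nat) := Y `&` [set y | (m.+1%:R^-1%:E <= hausdorff_content sg (fibre V A y))%E].
have YX : Y = \bigcup_m X m.
  apply/seteqP; split => [y Yy|y [m _ []//]].
  have [|b b0 b_le] := @gt0_ereal_ge_real _ (hausdorff_content sg (fibre V A y)).
    apply: hausdorff_content_gt0; first exact: ltW.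
    apply: (lt_le_trans _ Yy.2); rewrite lte_fin /sg; lra.
  have [m mb] := exists_inv_le b0; exists m => //; split => //=.
  by rewrite (le_trans _ b_le)// lee_fin.
have [m [b1 b10 Xb1]] : exists m, exists2 b1 : R, 0 < b1 &
    forall d, 0 < d -> d <= 1 -> forall s : seq (euclid R n),
    (forall y, X m y -> exists2 z, z \in s & mdist y z <= d) ->
    b1 <= (size s)%:R * d `^ tau.
  have [tau0|tau0] := leP 0 tau.
    have := hausdorff_content_gt0 tau0 tauY; rewrite YX.
    move=> /hausdorff_content_bigcup_gt0[m /gt0_ereal_ge_real[b b0 bX]]; exists m.
    exists (b / 2 `^ tau); first by rewrite divr_gt0// powR_gt0.
    move=> d d0 _ l lX; rewrite ler_pdivrMr ?powR_gt0// -mulrA -powRM// ?(ltW d0)//.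
    by rewrite (mulrC d) -lee_fin (le_trans bX)// hausdorff_content_card// ltW//.
  (* if [tau < 0], one point of [Y] is enough, as [d `^ tau >= 1] *)
  have [y] := Y0; rewrite YX => -[m _ Xy]; exists m, 1 => // d d0 d1 l lX.
  have [z zl _] := lX _ Xy.
  have l1 : 1 <= (size l)%:R :> R by rewrite ler1n; case: (l) zl.
  by rewrite -[leLHS]mulr1 ler_pM// -(powRr0 d) ger_powR ?d0 ?d1 ?(ltW tau0).
have m0 : 0 < m.+1%:R^-1 :> R by rewrite invr_gt0.
have [c [b [c0 b0 cb]]] := near_pairs_lower sg0 b10 m0 Xb1 (fun y Xy => Xy.2).
have cb0 : 0 < Num.min (Num.min c b) 1 by rewrite !lt_min c0 b0 ltr01.
have [N] := exists_inv_le cb0; rewrite !le_min -andbA => /and3P[Nc Nb N1].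
exists N => d d0 dN p a Aa.
apply: (@le_trans _ _ #|near_pairs V c d a|%:R); last first.
  rewrite ler_nat; apply: subset_leq_card; apply/fintype.subsetP => -[i j].
  rewrite !unfold_in/= => /andP[cij ->]; rewrite andbT.
  exact: le_trans cij.
apply: le_trans (cb _ d0 (le_trans dN Nc) _ a Aa).
rewrite ler_pM ?powR_ge0//.
rewrite ger_powR ?d0 ?(le_trans dN N1)//= lerN2 /sg /tau; lra.
Qed.

(** Double counting: among [p <= d `^ (- alpha)] balls covering [A] there are at
    most [p ^ 2] pairs, each of which is close in projection for at most about
    [d `^ (- (k * (n - k - 1)))] members of a spaced family of subspaces, while a
    rich subspace has at least about [d `^ (- kappa)] such pairs. *)
Lemma upper_box_dim_rich A (alpha kappa : R) N : (k < n)%N ->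
  (upper_box_dim A < alpha%:E)%E ->
  0 <= (k * (n - k - 1))%:R + 2 * alpha - kappa ->
  (upper_box_dim [set V | rich A kappa N V] <=
    ((k * (n - k - 1))%:R + 2 * alpha - kappa)%:E)%E.
Proof.
move=> kn /upper_box_dim_cover[d1 d10 Acov]; set r := _ - kappa => r0.
pose c : R := N.+1%:R^-1.
have c0 : 0 < c by rewrite invr_gt0.
have [C [K [d2 [C0 K0 d20 HK]]]] := spaced_near_orthogonal kn c0.
pose D := C * Num.min (Num.min d1 d2) c.
have D0 : 0 < D by rewrite mulr_gt0// !lt_min d10 d20.
apply: (@upper_box_dim_le _ _ _ _ (K / c * C `^ r) D) => // d d0.
rewrite /D -ler_pdivrMl// mulrC; set h := d / C.
have h0 : 0 < h by rewrite divr_gt0.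
have dE : d = C * h by rewrite mulrC divfK// gt_eqF.
rewrite !le_min -andbA => /and3P[hd1 hd2 hc].
have [p [a [Aa pA]]] := Acov h h0 hd1.
have bound (s : seq (grassmannian R n k)) : (forall V, V \in s -> rich A kappa N V) ->
    spaced d s -> (size s)%:R <= K / c * h `^ (- r).
  move=> sr ss; rewrite dE in ss.
  have h1 : (size s)%:R * (c * h `^ (- kappa)) <=
      \sum_(V <- s) #|near_pairs V c h a|%:R :> R.
    rewrite (_ : _ * _ = \sum_(V <- s) (c * h `^ (- kappa))); last first.
      by rewrite big_const_seq count_predT iter_addr_0 -[RHS]mulr_natl.
    rewrite big_seq [leRHS]big_seq; apply: ler_sum => V Vs.
    exact: sr.
  have h2 : \sum_(V <- s) #|near_pairs V c h a|%:R <=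
      p%:R ^+ 2 * (K * (h^-1) ^+ (k * (n - k - 1))).
    rewrite (eq_bigr (fun V => \sum_(ij : 'I_p * 'I_p) (near_pairs V c h a ij)%:R)); last first.
      move=> V _; rewrite -sum1_card natr_sum big_mkcond/=.
      by apply: eq_bigr => ij _; rewrite -[_ \in _]/(near_pairs V c h a ij); case: near_pairs.
    rewrite exchange_big/=.
    apply: (@le_trans _ _ (\sum_(ij : 'I_p * 'I_p) K * h^-1 ^+ (k * (n - k - 1)))); last first.
      by rewrite sumr_const card_prod card_ord -[leLHS]mulr_natl natrM expr2.
    apply: ler_sum => -[i j] _.
    have [cij|cij] := leP c (enorm (a i - a j)); last first.
      rewrite big1 ?mulr_ge0 ?exprn_ge0 ?invr_ge0 ?(ltW h0)// => V _.
      by rewrite /near_pairs/= leNgt cij.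
    rewrite (_ : \sum_(V <- s) _ =
      (size [seq V : grassmannian R n k <- s |
        enorm (orthproj V (a i - a j)) <= 2 * h])%:R); last first.
      rewrite size_filter -sum1_count natr_sum [RHS]big_mkcond; apply: eq_bigr => V _.
      by rewrite /near_pairs/= cij; case: ifP.
    apply: (HK h h0 hd2 _ cij); first exact: spaced_filter.
    by move=> V; rewrite mem_filter => /andP[].
  have h3 : p%:R ^+ 2 <= h `^ (- (2 * alpha)).
    rewrite [- _](_ : _ = (- alpha) * 2%:R); last by ring.
    by rewrite powRrM powR_mulrn ?powR_ge0// lerXn2r ?nnegrE ?powR_ge0.
  have := le_trans h1 h2; rewrite mulrA -ler_pdivlMr ?powR_gt0// -powRN opprK => h4.
  rewrite mulrAC ler_pdivlMr//.
  apply: (le_trans h4).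
  rewrite exprVn -powR_invn ?(ltW h0)//.
  apply: (@le_trans _ _ (h `^ (- (2 * alpha)) * (K * h `^ (- (k * (n - k - 1))%:R)) * h `^ kappa)).
    by rewrite !ler_wpM2r ?powR_ge0// mulr_ge0// powR_ge0.
  rewrite mulrCA -2!mulrA -!powRD ?(gt_eqF h0) ?implybT//.
  rewrite (_ : _ + _ = - r)//; rewrite /r; ring.
have [|s [sr ss scov]] := @maximal_spaced _ _ [set V | rich A kappa N V] d
    (Num.truncn (K / c * h `^ (- r))).
  move=> s sr ss; rewrite truncn_ge_nat ?bound//.
  by rewrite mulr_ge0 ?powR_ge0// divr_ge0// ltW.
apply: (le_trans (covering_number_le scov)); rewrite lee_fin.
rewrite (le_trans (bound s sr ss))// -[leRHS]mulrA ler_wpM2l ?divr_ge0 ?(ltW c0)//.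
by rewrite dE powRM ?(ltW C0) ?(ltW h0)// mulrA -powRD ?(gt_eqF C0) ?implybT// subrr powRr0 mul1r.
Qed.

End pair_counting.

(** * The exceptional set *)

Section exceptional_set.
Context {R : realType} {n k : nat}.
Implicit Types (V : grassmannian R n k) (A : set (euclid R n)).

Lemma mbounded_grassmannian (B : set (grassmannian R n k)) : mbounded B.
Proof.
exists 2 => V W _ _; rewrite grassmannian_mdistE.
rewrite (le_trans (opnormD _ _))// opnormN.
have H (U : grassmannian R n k) : opnorm (orthproj (grass_space U)) <= 1.
  by apply: opnorm_le => x x1; exact: le_trans (enorm_orthproj _ _) x1.
by rewrite (le_trans (lerD (H V) (H W))).
Qed.

(** Outside [F], the exceptional subspaces lie in countably many sets of upper box
    dimension at most [k * (n - k) - (k - s) + e]. *)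
Lemma exceptional_cover A (F : set (grassmannian R n k)) (s e : R) : (k < n)%N ->
  hausdorff_dim A = upper_box_dim A ->
  (forall V, ~ F V -> almost_dim_conserving (orthproj V) A) ->
  0 <= s -> (s%:E < hausdorff_dim A)%E -> 0 < e ->
  exists G : (set (grassmannian R n k))^nat,
    [set V : grassmannian R n k | (hausdorff_dim (orthproj V @` A) <= s%:E)%E] `\` F
      `<=` \bigcup_N G N /\
    forall N, (upper_box_dim (G N) <= ((k * (n - k - 1))%:R + s + e)%:E)%E.
Proof.
move=> kn Adim Fadc s0; case dimA : (hausdorff_dim A) => [alpha| |//] salpha e0; last first.
  (* if [A] has infinite dimension, no subspace outside [F] is exceptional *)
  exists (fun=> set0); split => [V [VA nFV]|N].
    have [_ [Delta _ /(_ 1 ltr01)]] := Fadc V nFV; rewrite dimA.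
    set Y := [set y | _] => DY.
    have Ys : (hausdorff_dim Y <= s%:E)%E.
      by apply: le_trans VA; apply: hausdorff_dim_le => y [].
    move: DY Ys; case: (hausdorff_dim Y) => [h| |//].
      by rewrite -EFinD leye_eq.
    by rewrite leye_eq.
  apply: (@upper_box_dim_le _ _ _ _ 0 1) => // [|d _ _].
    by rewrite addr_ge0 ?(ltW e0)// addr_ge0.
  by rewrite mul0r (le_trans (@covering_number_le _ _ _ _ [::] _)).
rewrite lte_fin in salpha.
(* [adc_rich] needs [4 * eta < alpha - s], and the bound given by
   [upper_box_dim_rich] exceeds [k * (n - k - 1) + s] by [7 * eta] *)
pose eta := Num.min (e / 7) ((alpha - s) / 8).
have eta0 : 0 < eta by rewrite lt_min !divr_gt0// subr_gt0.
have eta7 : eta <= e / 7 by rewrite ge_min lexx.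
have eta8 : eta <= (alpha - s) / 8 by rewrite ge_min lexx orbT.
have m0 : 0 <= (k * (n - k - 1))%:R :> R by [].
exists (fun N => [set V | rich A (2 * alpha - s - 5 * eta) N V]); split => [V [VA nFV]|N].
  have [|N VN] := adc_rich (Fadc V nFV) dimA VA eta0; first by move: eta8; lra.
  by exists N.
have Aalpha : (upper_box_dim A < (alpha + eta)%:E)%E.
  by rewrite -Adim dimA lte_fin ltrDl.
have := @upper_box_dim_rich _ _ _ A (alpha + eta) (2 * alpha - s - 5 * eta) N kn Aalpha.
set m := (k * _)%:R in m0 *; move=> h.
apply: (le_trans (h _)); first by move: m0 s0 eta0; lra.
by rewrite lee_fin; move: eta7; lra.
Qed.

End exceptional_set.

Theorem theorem1p5 (R : realType) (n k : nat) (k_ge1 : (1 <= k)%N)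
  (k_lt_n : (k < n)%N) (A : set (euclid R n)) (A_bounded : mbounded A)
  (A_dim : hausdorff_dim A = upper_box_dim A)
  (F : set (grassmannian R n k)) (t : \bar R) (t_def : t = packing_dim F)
  (F_adc : forall V : grassmannian R n k, ~ F V ->
     almost_dim_conserving (orthproj V) A)
  (s : R) (s_ge0 : 0 <= s) (s_lt : (s%:E < hausdorff_dim A)%E) :
  (packing_dim [set V : grassmannian R n k |
                 (hausdorff_dim (orthproj V @` A) <= s%:E)%E]
   <= maxe ((k * (n - k))%:R - (k%:R - s))%:E t)%E.
Proof.
set S := [set V | _]; set r := _ - (k%:R - s).
have rE : r = (k * (n - k - 1))%:R + s.
  rewrite /r -{1}(@subnK 1 (n - k)) ?subn_gt0// mulnDr muln1 natrD; ring.
have [ty|tNy] := eqVneq t +oo%E; first by rewrite ty maxey leey.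
have tfin : t \is a fin_num by rewrite ge0_fin_numE ?ltey// t_def packing_dim_ge0.
apply/lee_addgt0Pr => e e0.
have [G [SG Ge]] := exceptional_cover k_lt_n A_dim F_adc s_ge0 s_lt e0.
have [B FB Be] : exists2 B : (set (grassmannian R n k))^nat,
    F = \bigcup_i B i & forall i, (upper_box_dim (B i) <= t + e%:E)%E.
  by apply: packing_dim_lt; rewrite -t_def lteDl.
(* the pieces of [F] and those of [exceptional_cover], interleaved *)
pose H i := S `&` (if odd i then G i./2 else B i./2).
apply: (@packing_dim_le _ _ _ H) => [|i|i].
- apply/seteqP; split => [V SV|V [i _ []//]].
  have [FV|nFV] := pselect (F V).
    move: FV; rewrite FB => -[i _ BV]; exists i.*2 => //; rewrite /H odd_double doubleK.
    by split.
  have [i _ GV] := SG _ (conj SV nFV); exists i.*2.+1 => //.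
  by rewrite /H/= odd_double uphalf_double; split.
- exact: mbounded_grassmannian.
apply: (le_trans (upper_box_dim_mono (@subIsetr _ _ _))).
case: ifP => _.
  apply: (le_trans (Ge _)); rewrite EFinD -rE; apply: leeD => //.
  by rewrite le_max lexx.
by apply: (le_trans (Be _)); apply: leeD => //; rewrite le_max lexx orbT.
Qed.
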